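(* In the Normal Gibbs sampler setting described in the context, with $m:=\alpha+J/2$: (i) Let $K\ge0$ and assume $m>2$. Put $$r_1=\frac{(|\bar Y|\sqrt K+1)(|\bar Y|\sqrt K+\frac12)}{m-1},\qquad A=\frac{m(|\bar Y|\sqrt K+1)(|\bar Y|\sqrt K+\frac12)}{\Sigma_0^2},$$ and, for $\epsilon>0$, $r_{1,\epsilon}=r_1+\epsilon A$. If $r_{1,\epsilon}<1$, then for all $x>0$ and all $n\ge1$, $$d_{\mathrm{W}}(P_K^n(x,\cdot),\pi_K)\le\frac{\hat C_{1,\epsilon,x}}{1-r_{1,\epsilon}}\,r_{1,\epsilon}^{\,n},$$ where $$\hat C_{1,\epsilon,x}=\Bigl(x+\frac{m}{\Sigma_0}\Bigr)\left(\max\Bigl\{\frac1{\epsilon x^2},1\Bigr\}+\frac{N_x}{\epsilon(m-1)(m-2)}\right),$$ $$N_x=\Sigma_0^2+\frac{J\Sigma_0}{xJ+K}\Bigl[\frac{(\bar YK)^2}{xJ+K}+1\Bigr]+\frac{J^2}{4(xJ+K)^2}\Bigl[\frac{(\bar YK)^4}{(xJ+K)^2}+\frac{6(\bar YK)^2}{xJ+K}+3\Bigr].$$ (ii) Assume $K=1$ and let $r_2=m\,\frac{J^2}{\Sigma_0^2}(|\bar Y|+1)(|\bar Y|+\frac12)$. If $r_2<1$, then for all $x>0$ and all $n\ge1$, $$d_{\mathrm{W}}(P_1^n(x,\cdot),\pi_1)\le\frac{x+m/\Sigma_0}{1-r_2}\,r_2^{\,n}.$$ (iii) Assume $K=1$.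 Let $$r_3=\frac1{\sqrt{2\pi}}\left(4|\bar Y|\Bigl(1-\frac1{\sqrt{Jm/\Sigma_0+1}}\Bigr)+\log\Bigl(\frac{Jm}{\Sigma_0}+1\Bigr)\right),\qquad \hat A=\frac{(|\bar Y|+1)\,m\,J\sqrt{2\pi}}{2\Sigma_0^2},$$ and, for $\epsilon>0$, $r_{3,\epsilon}=r_3+\epsilon\hat A$. If $r_{3,\epsilon}<1$, then for all $x>0$ and all $n\ge1$, $$d_{\mathrm{W}}(P_1^n(x,\cdot),\pi_1)\le\frac{\hat C_{3,\epsilon,x}}{1-r_{3,\epsilon}}\,r_{3,\epsilon}^{\,n},\qquad \hat C_{3,\epsilon,x}=\max\Bigl\{1,\frac{J(2|\bar Y|+1)}{\epsilon\sqrt{2\pi}}\Bigr\}\Bigl(x+\frac{m}{\Sigma_0}\Bigr).$$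
   Context: Normal Gibbs sampler. Fix an integer $J\ge1$, real numbers $Y_1,\dots,Y_J$, and parameters $\alpha>0$, $\beta\ge0$, $K\ge0$. Put $\bar Y=\frac1J\sum_jY_j$ and $\Sigma_0=\beta+\frac12\sum_j(Y_j-\bar Y)^2$, assumed $>0$. Let $Z\sim N(0,1)$ and $G\sim\Gamma(\alpha+J/2,1)$ (density $g^{\alpha+J/2-1}e^{-g}/\Gamma(\alpha+J/2)$ on $(0,\infty)$) be independent, and define the random function $f:(0,\infty)\to(0,\infty)$, $$f(s)=\frac{G}{\Sigma_0+\frac J2\Bigl(\frac{Z}{\sqrt{sJ+K}}-\frac{\bar YK}{sJ+K}\Bigr)^2}.$$ With $f_1,f_2,\dots$ i.i.d. copies of $f$, consider the Markov chain $S_t=f_t(S_{t-1})$ on $(0,\infty)$. $P_K$ is its transition kernel, $P_K^n$ the $n$-step kernel, and $\pi_K$ its stationary distribution, which is the marginal law of $s$ under the probability density on $(\theta,s)\in\mathbb R\times(0,\infty)$ proportional to $s^{\alpha-1+J/2}\exp[-\beta s-\frac{K\theta^2}2-\frac s2\sum_j(Y_j-\theta)^2]$. $d_{\mathrm{W}}(\mu_1,\mu_2)=\inf_M\int\int|x-y|\,M(dx,dy)$, the infimum being over all couplings $M$ of the probability measures $\mu_1,\mu_2$ on $(0,\infty)$. *)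

(* Defs.v *)
From HB Require Import structures.
From mathcomp Require Import all_boot all_order all_algebra.
From mathcomp Require Import all_classical all_reals all_analysis.
From mathcomp Require Import measurable_realfun.

Set Implicit Arguments.
Unset Strict Implicit.
Unset Printing Implicit Defensive.

Import Order.TTheory GRing.Theory Num.Theory.
Import numFieldNormedType.Exports.

Local Open Scope classical_set_scope.
Local Open Scope ring_scope.

(* Probability measures on (0, +oo) are represented by Borel probability
   measures on R that give mass 1 to (0, +oo); a coupling of two such measures
   is then automatically carried by (0, +oo) ^ 2.  The kernel of the sampler is
   defined at every s : R, but only its values at s > 0 are meaningful: a chain
   started at x > 0 stays in (0, +oo) almost surely. *)

Section with_density.
Local Open Scope ereal_scope.
Context d (T : measurableType d) (R : realType).
Variables (mu : {measure set T -> \bar R}) (h : T -> R).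

Definition with_density (h0 : forall x, (0 <= h x)%R)
    (mh : measurable_fun [set: T] h) (A : set T) : \bar R :=
  \int[mu]_(x in A) (h x)%:E.

Variables (h0 : forall x, (0 <= h x)%R) (mh : measurable_fun [set: T] h).

Let with_density0 : with_density h0 mh set0 = 0.
Proof. exact: integral_set0. Qed.

Let with_density_ge0 A : 0 <= with_density h0 mh A.
Proof. by apply: integral_ge0 => x _; rewrite lee_fin. Qed.

Let with_density_sigma_additive : semi_sigma_additive (with_density h0 mh).
Proof.
apply: semi_sigma_additive_nng_induced; first exact/measurable_EFinP.
by move=> x; rewrite lee_fin.
Qed.

HB.instance Definition _ := isMeasure.Build _ _ _ (with_density h0 mh)
  with_density0 with_density_ge0 with_density_sigma_additive.

(* The probability with density proportional to h; the default value [point]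
   of [mnormalize] is only taken when the total mass of h is 0 or +oo. *)
Definition prob_propto : probability T R :=
  mnormalize (with_density h0 mh) point.

End with_density.

Section wasserstein.
Local Open Scope ereal_scope.
Context {R : realType}.
Local Notation rR := (measurableTypeR R).

Definition is_coupling (mu1 mu2 : set rR -> \bar R)
    (M : probability (rR * rR)%type R) : Prop :=
  (forall A : set rR, measurable A -> M (fst @^-1` A) = mu1 A) /\
  (forall A : set rR, measurable A -> M (snd @^-1` A) = mu2 A).

Definition wasserstein (mu1 mu2 : {measure set rR -> \bar R}) : \bar R :=
  ereal_inf [set \int[M]_z `|(z.1 : R) - (z.2 : R)|%:E |
             M in is_coupling mu1 mu2].

End wasserstein.

Section random_map_kernel.
Context d d' (X : measurableType d) (W : measurableType d') (R : realType).
Variables (P : probability W R) (f : X * W -> X).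

Definition random_map_kernel (mf : measurable_fun [set: X * W] f) (x : X) :
    {measure set X -> \bar R} :=
  distribution P (mfun_Sub (mem_set (measurable_fun_pair2 x mf))).

Variable mf : measurable_fun [set: X * W] f.

Let random_map_kernelE x U :
  random_map_kernel mf x U = P (xsection (f @^-1` U) x).
Proof. by rewrite xsectionE. Qed.

Let measurable_random_map_kernel U : measurable U ->
  measurable_fun [set: X] (random_map_kernel mf ^~ U).
Proof.
move=> mU; under eq_fun do rewrite random_map_kernelE.
apply: measurable_fun_xsection.
by rewrite -[X in measurable X]setTI; exact: mf.
Qed.

HB.instance Definition _ := @isKernel.Build _ _ _ _ R
  (random_map_kernel mf) measurable_random_map_kernel.

Let random_map_kernel_prob x : random_map_kernel mf x [set: X] = 1%E.
Proof. exact: probability_setT. Qed.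

HB.instance Definition _ := @Kernel_isProbability.Build _ _ _ _ R
  (random_map_kernel mf) random_map_kernel_prob.

End random_map_kernel.

Section kernel_iter.
Context d (X : measurableType d) (R : realType).

Let mkcomp_noparam_prob (k1 k2 : R.-pker X ~> X) x :
  mkcomp_noparam k1 k2 x [set: X] = 1%E.
Proof.
rewrite /mkcomp_noparam/= /kcomp_noparam.
under eq_integral do rewrite prob_kernel.
by rewrite integral_cst// mul1e prob_kernel.
Qed.

HB.instance Definition _ (k1 k2 : R.-pker X ~> X) :=
  isProbabilityKernel.Build _ _ _ _ R (mkcomp_noparam k1 k2)
    (mkcomp_noparam_prob k1 k2).

Fixpoint kernel_iter (k : R.-pker X ~> X) (n : nat) : R.-pker X ~> X :=
  if n is n'.+1 then mkcomp_noparam (kernel_iter k n') k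
  else kdirac (@measurable_id _ X [set: X]).

End kernel_iter.

Section gibbs.
Context {R : realType}.
Local Notation rR := (measurableTypeR R).

Lemma measurable_invr : measurable_fun [set: R] (@GRing.inv R).
Proof.
rewrite -(setvU [set (0 : R)]).
apply/measurable_funU => //; first exact: measurableC.
split; last exact: measurable_fun_set1.
apply: open_continuous_measurable_fun; first exact: closed_openC.
by move=> x; rewrite inE/= => /eqP x0; exact: inv_continuous.
Qed.

(* The unnormalised Gamma(a, 1) density; its total mass is Gamma(a), which is
   finite and positive for a > 0. *)
Definition gamma_fun (a x : R) : R :=
  if 0 < x then x `^ (a - 1) * expR (- x) else 0.

Lemma gamma_fun_ge0 a x : 0 <= gamma_fun a x.
Proof. by rewrite /gamma_fun; case: ifP => _ //; rewrite mulr_ge0 ?powR_ge0 ?expR_ge0. Qed.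

Lemma measurable_gamma_fun a : measurable_fun [set: rR] (gamma_fun a).
Proof.
apply: measurable_fun_ifT => //; first exact: measurable_fun_ltr.
by apply: measurable_funM => //; apply: measurableT_comp.
Qed.

Definition gamma_prob (a : R) : probability rR R :=
  prob_propto lebesgue_measure (gamma_fun_ge0 a) (measurable_gamma_fun a).

Variables (J : nat) (Y : 'I_J -> R) (alpha beta K : R).

Definition gibbs_mean : R := (\sum_j Y j) / J%:R.

Definition gibbs_Sigma0 : R := beta + 2^-1 * \sum_j (Y j - gibbs_mean) ^+ 2.

Definition gibbs_shape : R := alpha + J%:R / 2.

(* The joint law of (Z, G): Z and G are independent. *)
Definition gibbs_noise : probability (rR * rR)%type R :=
  (normal_prob 0 1 \x gamma_prob gibbs_shape)%E.

Definition gibbs_map (p : rR * (rR * rR)) : rR :=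
  let: (s, (z, g)) := p in
  g / (gibbs_Sigma0 + J%:R / 2 *
       (z / Num.sqrt (s * J%:R + K) - gibbs_mean * K / (s * J%:R + K)) ^+ 2).

Lemma measurable_gibbs_map : measurable_fun [set: rR * (rR * rR)] gibbs_map.
Proof.
have mden : measurable_fun [set: rR * (rR * rR)] (fun p => p.1 * J%:R + K).
  by apply: measurable_funD => //; apply: measurable_funM.
rewrite (_ : gibbs_map = fun p => p.2.2 / (gibbs_Sigma0 + J%:R / 2 *
    (p.2.1 / Num.sqrt (p.1 * J%:R + K) -
     gibbs_mean * K / (p.1 * J%:R + K)) ^+ 2)); last first.
  by apply/funext => -[s [z g]].
apply: measurable_funM; first exact: measurableT_comp.
apply: (measurableT_comp measurable_invr); apply: measurable_funD => //.
apply: measurable_funM => //; apply: measurable_funX.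
apply: measurable_funB; apply: measurable_funM => //.
- exact: measurableT_comp.
- apply: (measurableT_comp measurable_invr).
  apply: measurableT_comp => //.
  by apply: continuous_measurable_fun; exact: sqrt_continuous.
- exact: (measurableT_comp measurable_invr).
Qed.

Definition gibbs_kernel : R.-pker rR ~> rR :=
  random_map_kernel gibbs_noise measurable_gibbs_map.

(* The unnormalised density of (theta, s).  Its total mass is positive and
   finite when 0 < J, 0 < alpha, 0 <= beta, 0 <= K and 0 < gibbs_Sigma0. *)
Definition gibbs_joint_fun (p : rR * rR) : R :=
  let: (theta, s) := p in
  if 0 < s then
    s `^ (alpha - 1 + J%:R / 2) *
    expR (- beta * s - K * theta ^+ 2 / 2
          - s / 2 * \sum_j (Y j - theta) ^+ 2)
  else 0.

Lemma gibbs_joint_fun_ge0 p : 0 <= gibbs_joint_fun p.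
Proof.
by case: p => t s /=; case: ifP => _ //; rewrite mulr_ge0 ?powR_ge0 ?expR_ge0.
Qed.

Lemma measurable_gibbs_joint_fun :
  measurable_fun [set: rR * rR] gibbs_joint_fun.
Proof.
pose t (p : rR * rR) : R := p.1; pose s (p : rR * rR) : R := p.2.
have mt : measurable_fun [set: rR * rR] t by exact: measurable_fst.
have ms : measurable_fun [set: rR * rR] s by exact: measurable_snd.
rewrite (_ : gibbs_joint_fun = fun p => if 0 < s p then
    s p `^ (alpha - 1 + J%:R / 2) *
    expR (- beta * s p - K * t p ^+ 2 / 2
          - s p / 2 * \sum_j (Y j - t p) ^+ 2) else 0); last first.
  by apply/funext => -[].
apply: measurable_fun_ifT => //; first exact: measurable_fun_ltr.
apply: measurable_funM; first exact: (measurableT_comp (measurable_powR _)).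
apply: measurableT_comp => //.
apply: measurable_funB; last first.
  apply: measurable_funM; first exact: measurable_funM.
  apply: measurable_sum => j.
  by apply: measurable_funX; exact: measurable_funB.
apply: measurable_funB; first exact: measurable_funM.
apply: measurable_funM => //; apply: measurable_funM => //.
exact: measurable_funX.
Qed.

Definition gibbs_joint : probability (rR * rR)%type R :=
  prob_propto (lebesgue_measure \x lebesgue_measure)%E
    gibbs_joint_fun_ge0 measurable_gibbs_joint_fun.

Definition gibbs_stationary : probability rR R :=
  distribution gibbs_joint (mfun_Sub (mem_set measurable_snd)).

End gibbs.

(* Main.v *)
Require Import Defs.
From HB Require Import structures.
From mathcomp Require Import all_boot all_order all_algebra.
From mathcomp Require Import all_classical all_reals all_analysis.
From mathcomp Require Import measurable_realfun ring lra.

Set Implicit Arguments.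
Unset Strict Implicit.
Unset Printing Implicit Defensive.

Import Order.TTheory GRing.Theory Num.Theory.
Import numFieldNormedType.Exports.

Local Open Scope classical_set_scope.
Local Open Scope ring_scope.

(** Run two copies of the chain with the same random maps, one started at x and
    the other in the stationary law pi.  Suppose that a potential H satisfies,
    for all s, t > 0,
      E |H (f s) - H (f t)| <= rho |H s - H t|  with rho < 1,  and
      E |f s - f t| <= A |H s - H t|.
    After n + 1 steps the copies are at mean distance at most
    A rho ^ n E |H x - H S|, where S has law pi; as f S has law pi too,
    E |H x - H S| <= E |H x - H (f x)| + rho E |H x - H S|, so that this mean is
    at most E |H x - H (f x)| / (1 - rho).  This is [wasserstein_random_map].
    The law of s under the joint density of (theta, s) is stationary because f
    draws theta from its normal law given s, then s from its Gamma law given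
    theta ([gibbs_stationaryP]).

    Write p = 1 / sqrt (J s + K), b = Ybar K and W = Z p - b p ^ 2, so that
    f(s) = G / (Sigma0 + J / 2 W ^ 2).  The difference of the W ^ 2 for two
    starting points is the difference of the p ^ 2 times two affine functions of
    Z, hence has an explicit mean bound ([gibbs_shift_sqdiff_le]).  The three
    estimates come from three potentials.

    - H = 1 / s: 1 / f(s) is affine in W ^ 2 and E (1 / G) = 1 / (m - 1).

    - H = s: the same bound on W ^ 2, with E G = m, gives rho = A.

    - H = (log (J s + 1) - 4 |Ybar| / sqrt (J s + 1)) / sqrt (2 pi): given G,
      E |H (f x) - H (f y)| is the integral over the levels v of the probability
      that v separates H (f x) from H (f y) ([integral_separation_le]).  The set
      {H (f s) < v} is {|W| > r} for some r, so a separating level confines Z to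
      one of two intervals with end points r / p + Ybar p, respectively
      - r / p + Ybar p, which depend on s through p alone; as the normal density
      phi(u) and |u| phi(u) are at most 1 / sqrt (2 pi), each interval has
      probability at most half of |H x - H y| ([normal_prob_scale_itv]).  The
      levels fill the interval from H 0 to H (G / Sigma0), and Jensen's
      inequality for the concave H yields rho = H (m / Sigma0) - H 0.

    In the first and third cases the cost A of the last step is absorbed in the
    rate: A <= r / eps for r = rho + eps A ([wasserstein_gibbs]). *)

(** * Integration *)

Import HBNNSimple.

Section integration_tools.
Local Open Scope ereal_scope.
Context d (T : measurableType d) (R : realType).

(** The measures agree on simple functions; monotone convergence does the rest. *)
Lemma ge0_integral_density (mu nu : {measure set T -> \bar R}) (h : T -> R)
    (f : T -> \bar R) :
  (forall x, 0 <= h x)%R -> measurable_fun [set: T] h ->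
  (forall A, measurable A -> nu A = \int[mu]_(x in A) (h x)%:E) ->
  measurable_fun [set: T] f -> (forall x, 0 <= f x) ->
  \int[nu]_x f x = \int[mu]_x ((h x)%:E * f x).
Proof.
move=> h0 mh nuE mf f0; have mT : measurable [set: T] by [].
pose f_ := nnsfun_approx mT mf.
have fcvg x : (f_ n x)%:E @[n --> \oo] --> f x by exact: cvg_nnsfun_approx.
have fnd x m n : (m <= n)%N -> (f_ m x <= f_ n x)%R.
  by move=> mn; exact/lefP/nd_nnsfun_approx.
transitivity (limn (fun n => \int[nu]_x (f_ n x)%:E)).
  rewrite -monotone_convergence//.
  - by apply: eq_integral => x _; apply/esym/cvg_lim.
  - by move=> n; exact/measurable_EFinP.
  - by move=> n x _; rewrite lee_fin.
  - by move=> x _ m n mn; rewrite lee_fin fnd.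
transitivity (limn (fun n => \int[mu]_x ((h x)%:E * (f_ n x)%:E))); last first.
  rewrite -monotone_convergence//.
  - apply: eq_integral => x _; apply/cvg_lim => //.
    by apply: cvgeZl => //; exact: fcvg.
  - move=> n; apply: emeasurable_funM; first exact/measurable_EFinP.
    exact/measurable_EFinP.
  - by move=> n x _; rewrite mule_ge0 ?lee_fin.
  - by move=> x _ m n mn; rewrite lee_wpmul2l ?lee_fin ?fnd.
congr (limn _); apply/funext => n.
transitivity (\sum_(r \in range (f_ n)) (r%:E * nu (f_ n @^-1` [set r]))).
  by rewrite -sintegralE integralT_nnsfun.
transitivity (\int[mu]_x (\sum_(r \in range (f_ n))
   (r * (h x * \1_(f_ n @^-1` [set r]) x))%:E)).
  rewrite ge0_integral_fsum//.
  - apply: eq_fsbigr => r /set_mem [x _ <-].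
    rewrite nuE// integral_mkcond.
    under [RHS]eq_integral do rewrite EFinM.
    rewrite ge0_integralZl//.
    + congr (_ * _); apply: eq_integral => y _.
      by rewrite patchE indicE; case: ifPn => // _; rewrite ?mulr1 ?mulr0.
    + by apply/measurable_EFinP; apply: measurable_funM => //; exact: measurable_indic.
    + by move=> y _; rewrite lee_fin mulr_ge0.
    + by rewrite lee_fin.
  - move=> r; apply/measurable_EFinP; apply: measurable_funM => //.
    by apply: measurable_funM => //; exact: measurable_indic.
  - move=> r x _; rewrite lee_fin.
    rewrite indicE; have [|] := boolP (x \in _); last by rewrite !mulr0.
    by move=> /set_mem/= <-; rewrite mulr1 mulr_ge0.
apply: eq_integral => x _.
rewrite [in RHS](fimfunE (f_ n) x) -fsumEFin// ge0_mule_fsumr.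
  by apply: eq_fsbigr => r _; rewrite -EFinM; congr EFin; rewrite mulrCA.
move=> r; rewrite lee_fin.
rewrite indicE; have [|] := boolP (x \in _); last by rewrite !mulr0.
by move=> /set_mem/= <-; rewrite mulr1.
Qed.

Lemma measure_integral_indic (mu : {measure set T -> \bar R}) (A : set T) :
  measurable A -> mu A = \int[mu]_x (\1_A x)%:E.
Proof. by move=> mA; rewrite integral_indic// setIT. Qed.

Lemma integral_gt0 (mu : {measure set T -> \bar R}) (A : set T) (f : T -> R) :
  measurable A -> 0 < mu A -> measurable_fun [set: T] f ->
  (forall x, 0 <= f x)%R -> (forall x, A x -> 0 < f x)%R ->
  0 < \int[mu]_x (f x)%:E.
Proof.
move=> mA muA mf f0 fA; rewrite lt_neqAle integral_ge0 ?andbT; last first.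
  by move=> x _; rewrite lee_fin.
apply/negP => /eqP int0; have : \int[mu]_x `|(f x)%:E| = 0.
  by rewrite [RHS]int0; apply: eq_integral => x _; rewrite gee0_abs ?lee_fin.
move/ae_eq_integral_abs => /(_ measurableT) [].
  exact/measurable_EFinP.
move=> N [mN N0 sub]; have : mu A <= mu N.
  rewrite le_measure ?inE// => x Ax; apply: sub => /= /(_ Logic.I) [] fx0.
  by have := fA _ Ax; rewrite fx0 ltxx.
by rewrite N0 leNgt muA.
Qed.

End integration_tools.

Section kernel_composition.
Local Open Scope ereal_scope.
Context d1 d2 d3 (X : measurableType d1) (Y : measurableType d2)
  (Z : measurableType d3) (R : realType).

Lemma ge0_integral_mkcomp_noparam (k1 : R.-pker X ~> Y) (k2 : R.-pker Y ~> Z)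
    x (f : Z -> \bar R) :
  (forall z, 0 <= f z) -> measurable_fun [set: Z] f ->
  \int[mkcomp_noparam k1 k2 x]_z f z = \int[k1 x]_y \int[k2 y]_z f z.
Proof.
move=> f0 mf; rewrite -(integral_kcomp k1 (kernel.kernel_snd k2 : R.-spker _ ~> _))//.
Qed.

Lemma ge0_integral_random_map_kernel d (W : measurableType d)
    (P : probability W R) (f : X * W -> X) (mf : measurable_fun [set: X * W] f)
    x (h : X -> \bar R) :
  measurable_fun [set: X] h -> (forall y, 0 <= h y) ->
  \int[random_map_kernel P mf x]_y h y = \int[P]_w h (f (x, w)).
Proof. by move=> mh h0; rewrite ge0_integral_distribution. Qed.

End kernel_composition.

Section affine_substitution.
Local Open Scope ereal_scope.
Context (R : realType).
Local Notation mu := (@lebesgue_measure R).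
Local Notation rR := (measurableTypeR R).

(** Lebesgue measure is a times its image under x |-> a x + b, since both give
    intervals their length. *)
Lemma ge0_integral_affine (a b : R) (f : R -> \bar R) : (0 < a)%R ->
  measurable_fun [set: R] f -> (forall x, 0 <= f x) ->
  \int[mu]_x f x = a%:E * \int[mu]_x f (a * x + b)%R.
Proof.
move=> a0 mf f0.
pose phi : rR -> rR := fun x => (a * x + b)%R.
have mphi : measurable_fun [set: rR] phi.
  by apply: measurable_funD => //; exact: measurable_funM.
have a0' : (0 <= a)%R by exact: ltW.
pose nu' : {measure set rR -> \bar R} :=
  mscale (NngNum a0') (pushforward mu phi).
pose nu := nu' mphi.
have muE A : measurable A -> mu A = nu A.
  apply: lebesgue_measure_unique => _ [[u v]] _ <-.
  rewrite /nu/= /mscale/= /pushforward/=.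
  rewrite (_ : _ @^-1` _ = `](u - b) / a, (v - b) / a]%classic)%R; last first.
    apply/seteqP; split => x /=; rewrite !in_itv/= /phi.
      by rewrite ltr_pdivrMr// ler_pdivlMr// ltrBlDr lerBrDr mulrC.
    by rewrite ltr_pdivrMr// ler_pdivlMr// ltrBlDr lerBrDr mulrC.
  rewrite !lebesgue_measure_itv/= !lte_fin ltr_pM2r ?invr_gt0// ltrD2r.
  case: ifPn => _; last by rewrite mule0.
  by rewrite -!EFinB -EFinM; congr EFin; field; rewrite gt_eqF.
rewrite (eq_measure_integral nu)//=; last by move=> A mA _; exact: muE.
rewrite ge0_integral_mscale//=.
by rewrite ge0_integral_pushforward.
Qed.

Lemma cvgy_ln : (ln x @[x --> +oo%R] --> (+oo%R : set_system R)).
Proof.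
apply/cvgryPge => A; near=> x.
rewrite -[leLHS]expRK ler_ln ?posrE ?expR_gt0//.
Unshelve. all: by end_near. Qed.

Lemma integral_expRN_tail (t : R) : (0 < t)%R ->
  \int[mu]_(y in `[1%R, +oo[) (expR (- (y * t)))%:E = (expR (- t) / t)%:E.
Proof.
move=> t0.
have cexp : continuous (fun y : R => expR (- (y * t))).
  move=> y; apply: continuous_comp; last exact: continuous_expR.
  by apply: continuousN; apply: continuousM => //; exact: cvg_cst.
rewrite (@ge0_continuous_FTC2y _ _ (fun y => - (expR (- (y * t)) / t))%R _ 0%R).
- by rewrite sub0e -EFinN opprK mul1r.
- by move=> *; exact: expR_ge0.
- exact: continuous_subspaceT.
- rewrite -[X in _ --> X]oppr0 -[X in _ --> (- X)%R](mul0r (t^-1)%R).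
  apply: cvgN; apply: cvgMl.
  apply: (@cvg_comp _ _ _ (fun y => y * t)%R (fun z => expR (- z))%R
     _ (+oo%R : set_system R)); last exact: cvgr_expR.
  exact: gt0_cvgMly.
- by move=> y _; apply: ex_derive.
- apply: cvg_at_right_filter; apply: cvgN; apply: cvgMl; exact: cexp.
- move=> y _; rewrite derive1E derive_val/=.
  rewrite scaler0 add0r scaler0 add0r /GRing.scale/=.
  by field; rewrite gt_eqF.
Qed.

Lemma integral_powRN_tail (a : R) : (0 < a)%R ->
  \int[mu]_(y in `[1%R, +oo[) (y `^ (- a - 1))%:E = (a^-1)%:E.
Proof.
move=> a0.
have dpow (b x : R) : (0 < x)%R -> derivable (@powR R ^~ b) x 1.
  by move=> x0; apply: ex_derive; exact: is_derive1_powR.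
rewrite (@ge0_continuous_FTC2y _ _ (fun y => - (y `^ (- a) / a))%R _ 0%R).
- by rewrite sub0e -EFinN opprK powR1 mul1r.
- by move=> *; exact: powR_ge0.
- apply: derivable_within_continuous => x; rewrite in_itv/= andbT => x1.
  by apply: dpow; exact: lt_le_trans x1.
- rewrite -[X in _ --> X]oppr0 -[X in _ --> (- X)%R](mul0r (a^-1)%R).
  apply: cvgN; apply: cvgMl.
  have lim : expR (- (a * ln y)) @[y --> +oo%R] --> (0 : R)%R.
    apply: (@cvg_comp _ _ _ (fun y => a * ln y)%R (fun z => expR (- z))%R
     (+oo%R : set_system R) (+oo%R : set_system R)); last exact: cvgr_expR.
    by apply: gt0_cvgMry => //; exact: cvgy_ln.
  apply: cvg_trans lim.
  apply: near_eq_cvg; near=> y; rewrite /= /powR gt_eqF ?mulNr//.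
- move=> y y1; apply: derivableN; apply: derivableM => //.
  by apply: dpow; exact: lt_trans y1.
- apply: cvg_at_right_filter; apply: cvgN; apply: cvgMl.
  have cpow : {for 1%R, continuous (@powR R ^~ (- a)%R)}.
    by apply/differentiable_continuous/derivable1_diffP; exact: dpow.
  exact: cpow.
- move=> y; rewrite in_itv/= andbT => y1; have y0 : (0 < y)%R by exact: lt_trans y1.
  rewrite derive1E.
  have dy := is_derive1_powR (- a)%R y0.
  rewrite derive_val scaler0 add0r /GRing.scale/=.
  by field; rewrite gt_eqF.
Unshelve. all: by end_near. Qed.

(** A substitute for integration by parts: integrating over l >= 1 the
    hypothesis on g exp(- l tau), whose right-hand side comes from a change of
    scale, produces 1 / tau on the left and 1 / a on the right. *)
Lemma laplace_divide (g tau : R -> R) (a : R) (C : \bar R) :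
  (0 < a)%R -> measurable_fun [set: R] g -> measurable_fun [set: R] tau ->
  (forall x, 0 <= g x)%R -> (forall x, 0 <= tau x)%R ->
  (forall x, tau x = 0 -> g x = 0)%R -> 0 <= C ->
  (forall l : R, (1 <= l)%R -> \int[mu]_x (g x * expR (- (l * tau x)))%:E =
     (l `^ (- a - 1))%:E * C) ->
  \int[mu]_x (g x / tau x * expR (- tau x))%:E = a^-1%:E * C.
Proof.
move=> a0 mg mt g0 t0 gt C0 scal.
pose D : set R := `[1%R, +oo[%classic.
have mD : measurable D by exact: measurable_itv.
pose F (p : rR * rR) : \bar R :=
  ((g p.1 * expR (- (p.2 * tau p.1))) * \1_D p.2)%:E.
have mF : measurable_fun [set: rR * rR] F.
  apply/measurable_EFinP; apply: measurable_funM; last first.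
    have mID : measurable_fun [set: rR] (\1_D : rR -> R).
      by exact: measurable_indic.
    exact: (measurableT_comp mID measurable_snd).
  apply: measurable_funM; first exact: (measurableT_comp mg measurable_fst).
  apply: measurableT_comp => //; apply: measurableT_comp => //.
  by apply: measurable_funM => //; exact: (measurableT_comp mt measurable_fst).
have F0 p : 0 <= F p by rewrite lee_fin !mulr_ge0 ?expR_ge0.
have := @fubini_tonelli _ _ _ _ R mu mu F mF F0.
have -> : \int[mu]_x \int[mu]_y F (x, y) =
    \int[mu]_x (g x / tau x * expR (- tau x))%:E.
  apply: eq_integral => x _.
  transitivity ((g x)%:E * \int[mu]_(y in D) (expR (- (y * tau x)))%:E).
    rewrite -ge0_integralZl//.
    + rewrite [RHS]integral_mkcond; apply: eq_integral => y _.
      rewrite /F/= patchE indicE; case: ifPn => _; rewrite ?mulr1 ?mulr0//.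
    + apply/measurable_EFinP; apply: measurableT_comp => //.
      by apply: measurableT_comp => //; exact: measurable_funM.
    + by rewrite lee_fin.
  have := t0 x; rewrite le_eqVlt => /predU1P[t00|tx0].
    by rewrite gt// mul0e !mul0r.
  by rewrite integral_expRN_tail// -EFinM; congr EFin; rewrite mulrA mulrAC.
move=> ->.
transitivity (\int[mu]_(y in D) ((y `^ (- a - 1))%:E * C)).
  rewrite [RHS]integral_mkcond; apply: eq_integral => y _.
  rewrite patchE; case: ifPn => [/set_mem/=|yD]; rewrite /D/= ?in_itv/= ?andbT.
    move=> y1; rewrite -scal//; apply: eq_integral => x _.
    by rewrite /F/= indicE mem_set ?mulr1// /D/= in_itv/= y1.
  by apply: integral0_eq => x _; rewrite /F/= indicE (negbTE yD) mulr0.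
rewrite ge0_integralZr//.
- by rewrite integral_powRN_tail.
- apply/measurable_EFinP; apply: measurable_funTS; exact: measurable_powR.
- by move=> y _; rewrite lee_fin powR_ge0.
Qed.

End affine_substitution.

(** * Moments of the Gamma and normal laws *)

Section density_prob.
Local Open Scope ereal_scope.
Context d (T : measurableType d) (R : realType).

Lemma ge0_integral_prob_propto (mu : {measure set T -> \bar R}) (h : T -> R)
    (h0 : forall x, (0 <= h x)%R) (mh : measurable_fun [set: T] h)
    (f : T -> \bar R) :
  let M := \int[mu]_x (h x)%:E in 0 < M -> M < +oo ->
  measurable_fun [set: T] f -> (forall x, 0 <= f x) ->
  \int[prob_propto mu h0 mh]_x f x =
  ((fine M)^-1)%:E * \int[mu]_x ((h x)%:E * f x).
Proof.
move=> M M0 Moo mf f0.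
have iM0 : (0 <= (fine M)^-1)%R by rewrite invr_ge0 fine_ge0// ltW.
rewrite [LHS](@ge0_integral_density _ _ _ mu _ (fun x => (fine M)^-1 * h x)%R)//.
- under eq_integral do rewrite EFinM -muleA.
  rewrite ge0_integralZl//.
  + by apply: emeasurable_funM => //; exact/measurable_EFinP.
  + by move=> x _; rewrite mule_ge0 ?lee_fin.
- by move=> x; rewrite mulr_ge0.
- exact: measurable_funM.
- move=> A mA; rewrite /prob_propto/= /mnormalize/=.
  have -> : with_density mu h0 mh [set: T] = M by [].
  rewrite gt_eqF//= lt_eqF//= /with_density muleC.
  under [RHS]eq_integral do rewrite EFinM.
  rewrite ge0_integralZl//.
  + by apply/measurable_EFinP; exact: measurable_funTS.
  + by move=> x _; rewrite lee_fin.
Qed.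

End density_prob.

Section gamma_law.
Local Open Scope ereal_scope.
Context (R : realType).
Local Notation mu := (@lebesgue_measure R).
Local Notation rR := (measurableTypeR R).
Implicit Types (a D x : R) (F : R -> \bar R).

Definition gamma_mass a : \bar R := \int[mu]_x (gamma_fun a x)%:E.

Definition gamma_rate_fun a D x : R :=
  if (0 < x)%R then (x `^ (a - 1) * expR (- (D * x)))%R else 0%R.

Lemma gamma_rate_fun_ge0 a D x : (0 <= gamma_rate_fun a D x)%R.
Proof.
by rewrite /gamma_rate_fun; case: ifP => // _; rewrite mulr_ge0 ?powR_ge0 ?expR_ge0.
Qed.

Lemma measurable_gamma_rate_fun a D :
  measurable_fun [set: rR] (gamma_rate_fun a D).
Proof.
apply: measurable_fun_ifT => //; first exact: measurable_fun_ltr.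
apply: measurable_funM => //; apply: measurableT_comp => //.
by apply: measurableT_comp => //; exact: measurable_funM.
Qed.

Let powRD_gt0 x r s : (0 < x)%R -> (x `^ (r + s) = x `^ r * x `^ s)%R.
Proof. by move=> x0; rewrite powRD// (gt_eqF x0) implybT. Qed.

Lemma gamma_fun_scale a D x : (0 < D)%R ->
  (D * gamma_fun a (D * x) = D `^ a * gamma_rate_fun a D x)%R.
Proof.
move=> D0; rewrite /gamma_fun /gamma_rate_fun pmulr_rgt0//.
case: ifPn => x0; last by rewrite !mulr0.
have -> : (D `^ a = D * D `^ (a - 1))%R.
  rewrite -[X in (X * _)%R](powRr1 (ltW D0)) -powRD_gt0//.
  by rewrite addrCA subrr addr0.
by rewrite powRM ?ltW//; ring.
Qed.

Lemma gamma_fun_shift a b x : (0 < x)%R ->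
  (gamma_fun a x * x `^ b = gamma_fun (a + b) x)%R.
Proof.
move=> x0; rewrite /gamma_fun x0 mulrAC -powRD_gt0//.
by rewrite addrAC.
Qed.

Lemma integral_gamma_rate a D F : (0 < D)%R ->
  measurable_fun [set: R] F -> (forall x, 0 <= F x) ->
  \int[mu]_x ((gamma_fun a x)%:E * F (x / D)%R) =
  (D `^ a)%:E * \int[mu]_x ((gamma_rate_fun a D x)%:E * F x).
Proof.
move=> D0 mF F0.
have mFD : measurable_fun [set: rR] (fun x : rR => F (x / D)%R).
  by apply: (measurableT_comp mF); exact: measurable_funM.
pose f x := (gamma_fun a x)%:E * F (x / D)%R.
have mf : measurable_fun [set: rR] f.
  apply: emeasurable_funM => //; apply/measurable_EFinP.
  exact: measurable_gamma_fun.
have f0 x : 0 <= f x by rewrite mule_ge0 ?lee_fin ?gamma_fun_ge0.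
pose g x := (gamma_rate_fun a D x)%:E * F x.
have mg : measurable_fun [set: rR] g.
  apply: emeasurable_funM => //; apply/measurable_EFinP.
  exact: measurable_gamma_rate_fun.
have g0 x : 0 <= g x by rewrite mule_ge0 ?lee_fin ?gamma_rate_fun_ge0.
rewrite -[LHS]/(\int[mu]_x f x) -[X in _ = _ * X]/(\int[mu]_x g x).
have mfD : measurable_fun [set: rR] (fun x : rR => f (D * x + 0)%R).
  by apply: (measurableT_comp mf); apply: measurable_funD => //; exact: measurable_funM.
rewrite (ge0_integral_affine 0 D0 mf f0).
have Ef : \int[mu]_x (D%:E * f (D * x + 0)%R) = D%:E * \int[mu]_x f (D * x + 0)%R.
  by apply: (ge0_integralZl mu measurableT mfD); rewrite // lee_fin ltW.
have Eg : \int[mu]_x ((D `^ a)%:E * g x) = (D `^ a)%:E * \int[mu]_x g x.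
  by apply: (ge0_integralZl mu measurableT mg); rewrite // lee_fin powR_ge0.
rewrite -Ef -Eg.
apply: eq_integral => x _; rewrite /f /g addr0 !muleA -!EFinM gamma_fun_scale//.
by rewrite mulrAC mulfV ?mul1r// gt_eqF.
Qed.

Lemma gamma_mass_rate a D : (0 < D)%R ->
  \int[mu]_x (gamma_rate_fun a D x)%:E = (D `^ (- a))%:E * gamma_mass a.
Proof.
move=> D0; have := integral_gamma_rate a D0 (measurable_cst (1 : \bar R)).
under [X in _ -> X = _]eq_integral do rewrite -[(gamma_rate_fun _ _ _)%:E]mule1.
under [X in _ -> _ = _ * X]eq_integral do rewrite -[(gamma_fun _ _)%:E]mule1.
move=> -> //.
by rewrite muleA -EFinM -powRD_gt0// addNr powRr0 mul1e.
Qed.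

Lemma gamma_mass_ge0 a : 0 <= gamma_mass a.
Proof. by apply: integral_ge0 => x _; rewrite lee_fin gamma_fun_ge0. Qed.

(** Dividing x^a exp(- l x) by x and integrating in l is the functional
    equation of the Gamma function. *)
Lemma gamma_massD1 a : (0 < a)%R -> gamma_mass (a + 1) = a%:E * gamma_mass a.
Proof.
move=> a0.
have := @laplace_divide R (fun x => if (0 < x)%R then x `^ a else 0)%R
  (fun x => `|x|)%R a (gamma_mass (a + 1)) a0.
have -> : \int[mu]_x ((if (0 < x)%R then x `^ a else 0) / `|x| *
    expR (- `|x|))%:E = gamma_mass a.
  apply: eq_integral => x _; congr EFin; rewrite /gamma_fun.
  case: ifPn => x0; last by rewrite !mul0r.
  by rewrite gtr0_norm// powRD_gt0// powR_inv1// ltW.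
move=> ->; first by rewrite muleA -EFinM mulfV ?gt_eqF// mul1e.
- by apply: measurable_fun_ifT => //; exact: measurable_fun_ltr.
- exact: measurableT_comp.
- by move=> x; case: ifPn => // _; exact: powR_ge0.
- by move=> x; exact: normr_ge0.
- by move=> x /eqP; rewrite normr_eq0 => /eqP ->; rewrite ltxx.
- exact: gamma_mass_ge0.
move=> l l1; rewrite (_ : - a - 1 = - (a + 1))%R; last by ring.
rewrite -gamma_mass_rate; last exact: lt_le_trans l1.
apply: eq_integral => x _; congr EFin; rewrite /gamma_rate_fun addrK.
by case: ifPn => x0; rewrite ?mul0r// gtr0_norm.
Qed.

(** Gamma(1) is the mass of the exponential law and the functional equation
    reaches every positive integer; it also reduces Gamma(a) to Gamma(a + 1),
    whose integrand is at most the sum of those of Gamma(1) and Gamma(n + 2) for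
    an integer n + 1 >= a. *)
Lemma gamma_mass_fin a : (0 < a)%R -> gamma_mass a < +oo.
Proof.
have mgam b : measurable_fun [set: rR] (EFin \o gamma_fun b : rR -> \bar R).
  by apply/measurable_EFinP; exact: measurable_gamma_fun.
have gam1 : gamma_mass 1 < +oo.
  apply: le_lt_trans (ltry 1%R).
  rewrite -[leRHS](@integral_exponential_pdf R 1%R)//.
  apply: ge0_le_integral => //.
  - by move=> x _; rewrite lee_fin gamma_fun_ge0.
  - exact: mgam.
  - by apply/measurable_EFinP; apply: measurable_exponential_pdf.
  - move=> x _; rewrite lee_fin /gamma_fun; case: ifPn => x0; last first.
      exact: exponential_pdf_ge0.
    rewrite subrr powRr0 (exponential_pdfE _ (ltW x0)).
    by rewrite [leRHS](_ : _ = (1 * expR (- 1 * x))%R)// mulNr !mul1r.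
have gamn n : gamma_mass n.+1%:R < +oo.
  elim: n => [//|n IH]; rewrite -[in ltLHS]natr1 gamma_massD1//.
  by rewrite lte_mul_pinfty ?lee_fin// ge0_fin_numE// gamma_mass_ge0.
move=> a0; rewrite -(@lte_pmul2l _ a%:E)// -gamma_massD1//.
have -> : a%:E * +oo = +oo by rewrite gt0_muley// lte_fin.
pose n := Num.trunc a.
have an : (a <= n.+1%:R)%R by rewrite ltW// truncnS_gt.
apply: (@le_lt_trans _ _ (gamma_mass 1 + gamma_mass (n.+2)%:R)); last first.
  exact: lte_add_pinfty gam1 (gamn n.+1).
have <- : \int[mu]_x ((gamma_fun 1 x)%:E + (gamma_fun n.+2%:R x)%:E) =
    gamma_mass 1 + gamma_mass n.+2%:R.
  by apply: ge0_integralD => //; try exact: mgam;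
    move=> x _; rewrite lee_fin gamma_fun_ge0.
apply: ge0_le_integral => //.
- by move=> x _; rewrite lee_fin gamma_fun_ge0.
- exact: mgam.
- by apply: emeasurable_funD; exact: mgam.
move=> x _; rewrite -EFinD lee_fin /gamma_fun; case: ifPn => x0; last by rewrite addr0.
rewrite -mulrDl ler_wpM2r ?expR_ge0// addrK subrr powRr0 -natr1 addrK.
have [x1|x1] := leP x 1%R.
  apply: (@le_trans _ _ (x `^ 0)%R); last by rewrite powRr0 lerDl powR_ge0.
  by rewrite ger_powR ?x0// ltW.
apply: (@le_trans _ _ (x `^ n.+1%:R)%R); last by rewrite lerDr.
by rewrite ler_powR// ltW.
Qed.

Lemma gamma_mass_gt0 a : 0 < gamma_mass a.
Proof.
apply: (@integral_gt0 _ rR R mu `[1%R, 2%R]%classic (gamma_fun a)).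
- exact: measurable_itv.
- rewrite [ltRHS](lebesgue_measure_itv `[1%R, 2%R])/= lte_fin ltr1n -EFinB lte_fin subr_gt0 ltr1n//.
- exact: measurable_gamma_fun.
- by move=> x; exact: gamma_fun_ge0.
- move=> x /=; rewrite in_itv/= => /andP[x1 _].
  rewrite /gamma_fun (lt_le_trans _ x1)// mulr_gt0 ?expR_gt0// powR_gt0//.
  exact: lt_le_trans x1.
Qed.

Lemma integral_gamma_prob a F : (0 < a)%R ->
  measurable_fun [set: R] F -> (forall x, 0 <= F x) ->
  \int[gamma_prob a]_x F x =
  ((fine (gamma_mass a))^-1)%:E * \int[mu]_x ((gamma_fun a x)%:E * F x).
Proof.
move=> a0 mF F0; rewrite /gamma_prob ge0_integral_prob_propto//.
- exact: gamma_mass_gt0.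
- exact: gamma_mass_fin.
Qed.

(** The law lives on the whole line, where the absolute value keeps the
    integrand nonnegative. *)
Lemma gamma_moment a b : (0 < a)%R -> (0 < a + b)%R ->
  \int[gamma_prob a]_x (`|x| `^ b)%:E =
  (fine (gamma_mass (a + b)) / fine (gamma_mass a))%:E.
Proof.
move=> a0 ab0.
have mp : measurable_fun [set: R] (fun x : rR => (`|x| `^ b)%:E).
  apply/measurable_EFinP; apply: (measurableT_comp (measurable_powR _)).
  exact: normr_measurable.
rewrite (integral_gamma_prob a0 mp); last by move=> x; rewrite lee_fin powR_ge0.
rewrite (_ : integral _ _ _ = gamma_mass (a + b)); last first.
  apply: eq_integral => x _; rewrite -EFinM; congr EFin.
  have [x0|x0] := ltP 0%R x; first by rewrite gtr0_norm// gamma_fun_shift.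
  by rewrite /gamma_fun ltNge x0/= mul0r.
rewrite mulrC EFinM fineK// ge0_fin_numE ?gamma_mass_ge0//.
exact: gamma_mass_fin.
Qed.

Let fgamma_massD1 a : (0 < a)%R ->
  (fine (gamma_mass (a + 1)) = a * fine (gamma_mass a))%R.
Proof.
move=> a0; rewrite gamma_massD1// fineM// ge0_fin_numE ?gamma_mass_ge0//.
exact: gamma_mass_fin.
Qed.

Let fgamma_mass_neq0 a : (0 < a)%R -> (fine (gamma_mass a) != 0)%R.
Proof.
by move=> a0; rewrite gt_eqF// fine_gt0// gamma_mass_gt0 gamma_mass_fin.
Qed.

Lemma gamma_mean a : (0 < a)%R -> \int[gamma_prob a]_x `|x|%:E = a%:E.
Proof.
move=> a0; under eq_integral do rewrite -[`|_|%R]powRr1//.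
rewrite gamma_moment// ?addr_gt0// fgamma_massD1// mulfK//.
exact: fgamma_mass_neq0.
Qed.

Lemma gamma_inv_mean a : (1 < a)%R ->
  \int[gamma_prob a]_x (`|x|^-1)%:E = ((a - 1)^-1)%:E.
Proof.
move=> a1; under eq_integral do rewrite -powR_inv1//.
have a10 : (0 < a - 1)%R by rewrite subr_gt0.
have am : (a = a - 1 + 1)%R by rewrite subrK.
rewrite gamma_moment//; last by rewrite am addr_gt0.
rewrite [in X in (_ / X)%R]am fgamma_massD1//; congr EFin; field.
by rewrite fgamma_mass_neq0// gt_eqF.
Qed.

End gamma_law.

Section normal_law.
Local Open Scope ereal_scope.
Context (R : realType).
Local Notation mu := (@lebesgue_measure R).
Local Notation rR := (measurableTypeR R).
Local Notation phi := (@normal_pdf R 0 1).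
Implicit Types (F : R -> \bar R) (k : nat).

Lemma normal_pdf01E (z : R) : phi z = (normal_peak 1 * expR (- (z ^+ 2 / 2)))%R.
Proof.
by rewrite normal_pdfE ?oner_eq0//= /normal_fun subr0 expr1n mulNr.
Qed.

Lemma integral_normal_prob F :
  measurable_fun [set: R] F -> (forall x, 0 <= F x) ->
  \int[normal_prob 0 1]_x F x = \int[mu]_x ((phi x)%:E * F x).
Proof.
move=> mF F0; apply: (@ge0_integral_density _ rR R mu _ phi) => //.
- by move=> x; exact: normal_pdf_ge0.
- exact: measurable_normal_pdf.
Qed.

Definition normal_even_moment k : \bar R := \int[mu]_x (phi x * x ^+ (2 * k))%:E.

Lemma normal_even_moment_prob k :
  \int[normal_prob 0 1]_x (x ^+ (2 * k))%:E = normal_even_moment k.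
Proof.
rewrite integral_normal_prob.
- by apply: eq_integral => x _; rewrite EFinM.
- by apply/measurable_EFinP; exact: measurable_funX.
- by move=> x; rewrite lee_fin exprn_even_ge0// mul2n odd_double.
Qed.

(** [laplace_divide] for tau = x ^ 2 / 2: the scaling hypothesis is the
    substitution x |-> sqrt l x. *)
Lemma normal_even_momentS k :
  normal_even_moment k = ((k%:R + 2^-1)^-1)%:E * (2^-1%:E * normal_even_moment k.+1).
Proof.
pose g (x : R) := (normal_peak 1 * (x ^+ (2 * k.+1) / 2))%R.
pose tau (x : R) := (x ^+ 2 / 2)%R.
have g0 x : (0 <= g x)%R.
  by rewrite mulr_ge0 ?normal_peak_ge0// divr_ge0// exprn_even_ge0// mul2n odd_double.
have mX n : measurable_fun [set: rR] (fun x : R => x ^+ n)%R by exact: measurable_funX.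
have mg : measurable_fun [set: rR] g.
  by apply: measurable_funM => //; exact: measurable_funM.
have mtau : measurable_fun [set: rR] tau by exact: measurable_funM.
have mphi : measurable_fun [set: rR] phi by exact: measurable_normal_pdf.
have tau0 x : (0 <= tau x)%R by rewrite divr_ge0// sqr_ge0.
have a0 : (0 < k%:R + 2^-1 :> R)%R by rewrite ltr_wpDl.
have C0 : 0 <= 2^-1%:E * normal_even_moment k.+1.
  rewrite mule_ge0 ?lee_fin//; apply: integral_ge0 => x _.
  rewrite lee_fin mulr_ge0 ?normal_pdf_ge0// exprn_even_ge0//.
  by rewrite mul2n odd_double.
rewrite -(@laplace_divide R g tau _ _ a0)//.
- apply: ge0_ae_eq_integral => //.
  + apply/measurable_EFinP; exact: measurable_funM.
  + apply/measurable_EFinP; apply: measurable_funM; last first.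
      by apply: measurableT_comp => //; exact: measurableT_comp.
    by apply: measurable_funM => //; exact: (measurableT_comp (measurable_invr)).
  + move=> x _; rewrite lee_fin mulr_ge0 ?normal_pdf_ge0// exprn_even_ge0//.
    by rewrite mul2n odd_double.
  + by move=> x _; rewrite lee_fin; apply: mulr_ge0; [exact: divr_ge0|exact: expR_ge0].
  exists [set 0%R]; split; first exact: measurable_set1.
    exact: lebesgue_measure_set1.
  move=> x /=; apply: contra_notP => /eqP x0 _; congr EFin.
  rewrite normal_pdf01E /g /tau mulnS exprD.
  by field.
- move=> x /eqP; rewrite /tau mulf_eq0 invr_eq0 pnatr_eq0 orbF sqrf_eq0 => /eqP ->.
  by rewrite /g mulnS expr0n/= mul0r mulr0.
move=> l l1; have l0 : (0 < l)%R by exact: lt_le_trans l1.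
have sl0 : (0 < Num.sqrt l)%R by rewrite sqrtr_gt0.
pose f (x : R) := (phi x * x ^+ (2 * k.+1))%:E.
have mf : measurable_fun [set: rR] f.
  by apply/measurable_EFinP; exact: measurable_funM.
have f0 x : 0 <= f x.
  rewrite lee_fin mulr_ge0 ?normal_pdf_ge0// exprn_even_ge0//.
  by rewrite mul2n odd_double.
rewrite /normal_even_moment -/(\int[mu]_x f x) (ge0_integral_affine 0%R sl0 mf f0).
have mfl : measurable_fun [set: rR] (fun x : rR => f (Num.sqrt l * x + 0)%R).
  by apply: (measurableT_comp mf); apply: measurable_funD => //; exact: measurable_funM.
rewrite !muleA -!EFinM.
have E : \int[mu]_x ((l `^ (- (k%:R + 2^-1) - 1) * 2^-1 * Num.sqrt l)%:E *
    f (Num.sqrt l * x + 0)%R) =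
  (l `^ (- (k%:R + 2^-1) - 1) * 2^-1 * Num.sqrt l)%:E *
  \int[mu]_x f (Num.sqrt l * x + 0)%R.
  by apply: (ge0_integralZl mu measurableT mfl); rewrite // lee_fin !mulr_ge0 ?powR_ge0 ?sqrtr_ge0.
rewrite -E; apply: eq_integral => x _; rewrite /f -EFinM; congr EFin.
rewrite normal_pdf01E /g /tau addr0 !exprMn sqr_sqrtr ?ltW// (exprM (Num.sqrt l)) sqr_sqrtr ?ltW//.
have -> : (- (k%:R + 2^-1) - 1 = - k.+1%:R - 2^-1 :> R)%R by rewrite -natr1; ring.
rewrite powRD ?(gt_eqF l0) ?implybT// powR_invn ?(ltW l0)// powRN powR12_sqrt ?(ltW l0)//.
rewrite mulrA; field.
by rewrite !gt_eqF// exprn_gt0.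
Qed.

Lemma normal_mass : normal_even_moment 0 = 1.
Proof.
rewrite -[RHS](@integral_normal_pdf R 0 1).
by apply: eq_integral => x _; rewrite muln0 expr0 mulr1.
Qed.

Lemma normal_mean_sqr : \int[normal_prob 0 1]_x (x ^+ 2)%:E = 1%E :> \bar R.
Proof.
rewrite (normal_even_moment_prob 1).
have := normal_even_momentS 0; rewrite normal_mass add0r muleA -EFinM invrK.
by rewrite mulfV ?mul1e.
Qed.

End normal_law.

(** * Contracting iterated random maps *)

Lemma measurable_normrB d (T : measurableType d) (R : realType) (u v : T -> R) :
  measurable_fun [set: T] u -> measurable_fun [set: T] v ->
  measurable_fun [set: T] (fun x => `|u x - v x|).
Proof.
move=> mu mv; apply: measurableT_comp; first exact: normr_measurable.
exact: measurable_funB.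
Qed.

Lemma integral_cst_probability d (T : measurableType d) (R : realType)
    (P : probability T R) (c : \bar R) : (\int[P]_x cst c x = c)%E.
Proof.
transitivity (c * P [set: T])%E; last by rewrite probability_setT mule1.
exact: integral_cst.
Qed.

Section contraction.
Local Open Scope ereal_scope.
Context (R : realType) d (W : measurableType d) (P : probability W R).
Local Notation rR := (measurableTypeR R).
Variables (f : rR * W -> rR) (mf : measurable_fun [set: rR * W] f).
Variable pi : probability rR R.
Implicit Types (h : rR -> \bar R) (x y : rR) (z : (rR * rR)%type).

Let k : R.-pker rR ~> rR := random_map_kernel P mf.

Hypothesis pi_stationary : forall h, measurable_fun [set: rR] h ->
  (forall y, 0 <= h y) -> \int[pi]_y \int[P]_w h (f (y, w)) = \int[pi]_y h y.
Hypothesis f_gt0 : forall y, {ae P, forall w, (0 < f (y, w))%R}.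

Let F (q : (rR * rR) * W) : (rR * rR)%type := (f (q.1.1, q.2), f (q.1.2, q.2)).

Let mF : measurable_fun [set: (rR * rR) * W] F.
Proof.
apply: measurable_fun_pair; apply: (measurableT_comp mf);
  apply: measurable_fun_pair => //; exact: measurableT_comp.
Qed.

Let F0 (q : (rR * rR) * rR) : (rR * rR)%type := (q.1.1, q.2).

Let mF0 : measurable_fun [set: (rR * rR) * rR] F0.
Proof.
by apply: measurable_fun_pair => //; exact: measurableT_comp.
Qed.

(** The law of two copies of the chain driven by the same maps, one started at
    z.1 and the other in the stationary law. *)
Fixpoint coupled_chain (n : nat) : R.-pker (rR * rR)%type ~> (rR * rR)%type :=
  if n is n'.+1 then mkcomp_noparam (coupled_chain n') (random_map_kernel P mF)
  else random_map_kernel pi mF0.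

Let measurable_step h : measurable_fun [set: rR] h -> (forall y, 0 <= h y) ->
  measurable_fun [set: rR] (fun y => \int[P]_w h (f (y, w))).
Proof.
move=> mh h0.
apply: (measurable_fun_fubini_tonelli_F (m2 := P) (fun q => h (f q))) => //.
exact: measurableT_comp.
Qed.

Let measurable_step2 (g : rR * rR -> \bar R) :
  measurable_fun [set: rR * rR] g -> (forall z, 0 <= g z) ->
  measurable_fun [set: rR * rR] (fun z => \int[P]_w g (F (z, w))).
Proof.
move=> mg g0.
apply: (measurable_fun_fubini_tonelli_F (m2 := P) (fun q => g (F q))) => //.
exact: measurableT_comp.
Qed.

Let integral_coupledS n z (g : rR * rR -> \bar R) :
  measurable_fun [set: rR * rR] g -> (forall z, 0 <= g z) ->
  \int[coupled_chain n.+1 z]_w g w =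
  \int[coupled_chain n z]_w \int[P]_v g (F (w, v)).
Proof.
move=> mg g0; rewrite ge0_integral_mkcomp_noparam//.
by apply: eq_integral => w _; rewrite ge0_integral_random_map_kernel.
Qed.

Let integral_iterS n x h : measurable_fun [set: rR] h -> (forall y, 0 <= h y) ->
  \int[kernel_iter k n.+1 x]_y h y =
  \int[kernel_iter k n x]_y \int[P]_w h (f (y, w)).
Proof.
move=> mh h0; rewrite ge0_integral_mkcomp_noparam//.
by apply: eq_integral => w _; rewrite ge0_integral_random_map_kernel.
Qed.

Let coupled_fst n z h : measurable_fun [set: rR] h -> (forall y, 0 <= h y) ->
  \int[coupled_chain n z]_w h w.1 = \int[kernel_iter k n z.1]_y h y.
Proof.
elim: n h => [|n IH] h mh h0.
  rewrite ge0_integral_random_map_kernel//; last exact: measurableT_comp.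
  rewrite [LHS](integral_cst_probability pi (h z.1)).
  by rewrite [RHS]integral_dirac// diracT mul1e.
rewrite integral_coupledS//; last exact: measurableT_comp.
rewrite integral_iterS// -IH//; first exact: measurable_step.
by move=> y; exact: integral_ge0.
Qed.

Let coupled_snd n z h : measurable_fun [set: rR] h -> (forall y, 0 <= h y) ->
  \int[coupled_chain n z]_w h w.2 = \int[pi]_y h y.
Proof.
elim: n h => [|n IH] h mh h0.
  by rewrite ge0_integral_random_map_kernel//; exact: measurableT_comp.
rewrite integral_coupledS//; last exact: measurableT_comp.
rewrite -pi_stationary// -IH//; first exact: measurable_step.
by move=> y; exact: integral_ge0.
Qed.

(* A kernel only provides measures; normalizing repackages the value as a
   probability without changing it. *)
Let coupling_prob n x : probability (rR * rR)%type R :=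
  mnormalize (coupled_chain n (x, x)) point.

Let coupling_probE n x A : coupling_prob n x A = coupled_chain n (x, x) A.
Proof.
rewrite /coupling_prob/= /mnormalize prob_kernel.
by rewrite gt_eqF ?lte_fin//= invr1 mule1.
Qed.

Let coupling_probP n x :
  is_coupling (kernel_iter k n x) pi (coupling_prob n x).
Proof.
have mind (A : set rR) : measurable A ->
    measurable_fun [set: rR] (fun y => (\1_A y)%:E : \bar R).
  by move=> mA; exact/measurable_EFinP/measurable_indic.
split => A mA; rewrite coupling_probE.
- rewrite measure_integral_indic; last first.
    by rewrite -[X in measurable X]setTI; exact: measurable_fst.
  rewrite [LHS](@coupled_fst n (x, x) (fun y => (\1_A y)%:E))//; last exact: mind.
  by rewrite -measure_integral_indic.
- rewrite measure_integral_indic; last first.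
    by rewrite -[X in measurable X]setTI; exact: measurable_snd.
  rewrite [LHS](@coupled_snd n (x, x) (fun y => (\1_A y)%:E))//; last exact: mind.
  by rewrite -measure_integral_indic.
Qed.

Let positive : set rR := [set y | (0 < y)%R].

Let mpositive : measurable positive.
Proof.
rewrite (_ : positive = `]0%R, +oo[%classic); first exact: measurable_itv.
by apply/seteqP; split => y /=; rewrite in_itv/= andbT.
Qed.

Let mnonpos : measurable_fun [set: rR] (fun y => (\1_(~` positive) y)%:E : \bar R).
Proof. by apply/measurable_EFinP/measurable_indic; exact: measurableC. Qed.

Let step_nonpos y : \int[P]_w (\1_(~` positive) (f (y, w)))%:E = 0.
Proof.
have mfy : measurable_fun [set: W] (fun w => f (y, w)).
  exact: measurableT_comp.
transitivity (\int[P]_w (cst 0 w) : \bar R); last exact: integral0.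
apply: ge0_ae_eq_integral => //.
  exact: (measurableT_comp mnonpos mfy).
have := f_gt0 y; apply: filterS => w fyw _.
by rewrite indicE memNset//= => /(_ fyw).
Qed.

(* One step leads into (0, +oo) from any point, and pi is the law of a step. *)
Let stationary_gt0 : pi (~` positive) = 0.
Proof.
have mC : measurable (~` positive) by exact: measurableC.
rewrite measure_integral_indic// -pi_stationary//.
transitivity (\int[pi]_y (cst 0 y) : \bar R); last exact: integral0.
by apply: eq_integral => y _; exact: step_nonpos.
Qed.

Let coupled_gt0 n x : (0 < x)%R ->
  {ae coupled_chain n (x, x), forall w, (0 < w.1)%R /\ (0 < w.2)%R}.
Proof.
move=> x0.
have mC : measurable (~` positive) by exact: measurableC.
pose B1 : set (rR * rR) := fst @^-1` (~` positive).
pose B2 : set (rR * rR) := snd @^-1` (~` positive).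
have m1 : measurable B1.
  by rewrite -[X in measurable X]setTI; exact: measurable_fst.
have m2 : measurable B2.
  by rewrite -[X in measurable X]setTI; exact: measurable_snd.
have E1 : coupled_chain n (x, x) B1 = 0.
  rewrite -[LHS]coupling_probE (coupling_probP n x).1//.
  case: n => [|n] /=.
    by rewrite /kdirac/= diracE memNset//= => /(_ x0).
  rewrite /mkcomp_noparam/= /kcomp_noparam.
  transitivity (\int[kernel_iter k n x]_y (cst 0 y) : \bar R); last exact: integral0.
  apply: eq_integral => y _; rewrite -[RHS](step_nonpos y).
  rewrite -(@ge0_integral_random_map_kernel _ _ _ _ _ P f mf y (fun y => (\1_(~` positive) y)%:E))//.
    exact: measure_integral_indic.
have E2 : coupled_chain n (x, x) B2 = 0.
  by rewrite -[LHS]coupling_probE (coupling_probP n x).2.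
have := @measureU0 _ _ _ (coupled_chain n (x, x)) _ _ m1 m2 E2; rewrite E1 => E.
exists (B1 `|` B2); split => //.
  exact: measurableU.
move=> w /= /not_andP[]; [left|right] => //.
Qed.

Lemma coupled_step_le n x (G B : rR * rR -> R) (c : R) : (0 < x)%R -> (0 <= c)%R ->
  measurable_fun [set: rR * rR] G -> (forall z, 0 <= G z)%R ->
  measurable_fun [set: rR * rR] B -> (forall z, 0 <= B z)%R ->
  (forall s t : R, (0 < s)%R -> (0 < t)%R ->
    \int[P]_w (G (f (s, w), f (t, w)))%:E <= (c * B (s, t))%:E) ->
  \int[coupled_chain n.+1 (x, x)]_z (G z)%:E <=
  c%:E * \int[coupled_chain n (x, x)]_z (B z)%:E.
Proof.
move=> x0 c0 mG G0 mB B0 GB.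
have mG' : measurable_fun [set: rR * rR] (fun z => (G z)%:E).
  exact/measurable_EFinP.
have mB' : measurable_fun [set: rR * rR] (fun z => (B z)%:E).
  exact/measurable_EFinP.
rewrite integral_coupledS//.
rewrite -ge0_integralZl//; last by move=> z _; rewrite lee_fin.
apply: ae_ge0_le_integral => //.
- by move=> z _; apply: integral_ge0 => w _; rewrite lee_fin.
- by apply: (measurable_step2 mG') => z; rewrite lee_fin.
- by move=> z _; rewrite mule_ge0 ?lee_fin.
- exact: measurable_funeM.
have [N [mN N0 subN]] := coupled_gt0 n x0.
exists N; split => // -[s t] /= nst; apply: subN => /= -[s0 t0].
by apply: nst => _; exact: GB.
Qed.

Variables (H : rR -> rR) (mH : measurable_fun [set: rR] H).
Variables (rho C x : R).
Hypotheses (rho_gt0 : (0 < rho)%R) (rho_lt1 : (rho < 1)%R) (x_gt0 : (0 < x)%R).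
Hypothesis H_contract : forall s t : R, (0 < s)%R -> (0 < t)%R ->
  \int[P]_w `|H (f (s, w)) - H (f (t, w))|%:E <= (rho * `|H s - H t|)%:E.
Hypothesis H_start : \int[P]_w `|H x - H (f (x, w))|%:E <= C%:E.

(* The expectation of |H x - H y| under pi could be infinite a priori.  Cutting
   the distance off at N keeps it finite, and one step of the stationary chain
   replaces the index j by j + 1 at the price of rho ^ j C; the remainder
   vanishes as j grows, and N is sent to infinity last. *)
Let trunc (N : R) j (y : R) : \bar R := (Num.min N (rho ^+ j * `|H x - H y|))%:E.

Let dist_ge0 j y : (0 <= rho ^+ j * `|H x - H y|)%R.
Proof. by rewrite mulr_ge0// exprn_ge0// ltW. Qed.

Let trunc_ge0 N j y : (0 <= N)%R -> 0 <= trunc N j y.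
Proof. by move=> N0; rewrite lee_fin le_min N0 dist_ge0. Qed.

Let mdist : measurable_fun [set: rR] (fun y => `|H x - H y|%R).
Proof. by exact: measurable_normrB. Qed.

Let mtrunc N j : measurable_fun [set: rR] (trunc N j).
Proof.
apply/measurable_EFinP; apply: measurable_minr => //.
exact: measurable_funM.
Qed.

Let trunc_step N j y : (0 <= N)%R -> (0 < y)%R ->
  \int[P]_w trunc N j (f (y, w)) <= (rho ^+ j * C)%:E + trunc N j.+1 y.
Proof.
move=> N0 y0; have rj0 : (0 <= rho ^+ j)%R by rewrite exprn_ge0// ltW.
have mfs s : measurable_fun [set: W] (fun w => H (f (s, w))).
  by apply: (measurableT_comp mH); exact: measurableT_comp.
pose u w := (rho ^+ j * `|H x - H (f (x, w))|)%R.
pose v w := (rho ^+ j * `|H (f (x, w)) - H (f (y, w))|)%R.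
have mu' : measurable_fun [set: W] u.
  by apply: measurable_funM => //; apply: measurable_normrB => //; exact: mfs.
have mv : measurable_fun [set: W] v.
  by apply: measurable_funM => //; apply: measurable_normrB => //; exact: mfs.
have u0 w : (0 <= u w)%R by rewrite mulr_ge0.
have v0 w : (0 <= v w)%R by rewrite mulr_ge0.
have mm : measurable_fun [set: W] (fun w => Num.min N (v w)).
  exact: measurable_minr.
have m0 w : (0 <= Num.min N (v w))%R by rewrite le_min N0 v0.
apply: (@le_trans _ _ (\int[P]_w ((u w)%:E + (Num.min N (v w))%:E))).
  apply: ge0_le_integral => //.
  - by move=> w _; exact: trunc_ge0.
  - apply: (measurableT_comp (mtrunc N j)); exact: measurableT_comp.
  - by apply/measurable_EFinP; exact: measurable_funD.
  move=> w _; rewrite -EFinD lee_fin.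
  rewrite ge_min; have [Nv|vN] := leP N (v w).
    by rewrite lerDr u0.
  rewrite -mulrDr ler_wpM2l ?orbT//.
  by rewrite (le_trans _ (ler_normD _ _))// addrA subrK.
rewrite ge0_integralD//; last 4 first.
- by move=> w _; rewrite lee_fin.
- exact/measurable_EFinP.
- by move=> w _; rewrite lee_fin.
- exact/measurable_EFinP.
apply: leeD.
  under eq_integral do rewrite EFinM.
  rewrite ge0_integralZl//.
  - by rewrite EFinM lee_wpmul2l ?lee_fin.
  - by apply/measurable_EFinP; apply: measurable_normrB => //; exact: mfs.
rewrite /trunc EFin_min le_min; apply/andP; split.
  apply: (@le_trans _ _ (\int[P]_w (cst N%:E w))).
    apply: ge0_le_integral => //.
    - by move=> w _; rewrite lee_fin.
    - exact/measurable_EFinP.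
    - by move=> w _; rewrite lee_fin ge_min lexx.
  by rewrite integral_cst_probability.
apply: (@le_trans _ _ (\int[P]_w (v w)%:E)).
  apply: ge0_le_integral => //.
  - by move=> w _; rewrite lee_fin.
  - exact/measurable_EFinP.
  - exact/measurable_EFinP.
  - by move=> w _; rewrite lee_fin ge_min lexx orbT.
under eq_integral do rewrite EFinM.
rewrite ge0_integralZl//.
- rewrite exprSr -mulrA EFinM lee_wpmul2l ?lee_fin//.
  exact: H_contract.
- by apply/measurable_EFinP; apply: measurable_normrB => //; exact: mfs.
Qed.

Let C_ge0 : (0 <= C)%R.
Proof.
by rewrite -lee_fin (le_trans _ H_start)// integral_ge0// => w _; rewrite lee_fin.
Qed.

Let trunc_iter N j : (0 <= N)%R ->
  \int[pi]_y trunc N 0 y <= (C / (1 - rho))%:E + \int[pi]_y trunc N j y.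
Proof.
move=> N0.
have step i : \int[pi]_y trunc N i y <=
    (rho ^+ i * C)%:E + \int[pi]_y trunc N i.+1 y.
  rewrite -pi_stationary//; last by move=> y; exact: trunc_ge0.
  have -> : (rho ^+ i * C)%:E = \int[pi]_y (cst (rho ^+ i * C)%:E y).
    by rewrite integral_cst_probability.
  have rC0 : (0 <= rho ^+ i * C)%R by rewrite mulr_ge0// exprn_ge0// ltW.
  rewrite -ge0_integralD//; last first.
    by move=> y _; exact: trunc_ge0.
  apply: ae_ge0_le_integral => //.
  - by move=> y _; apply: integral_ge0 => w _; exact: trunc_ge0.
  - by apply: measurable_step => // y; exact: trunc_ge0.
  - by move=> y _; apply: adde_ge0; [rewrite lee_fin|exact: trunc_ge0].
  - exact: emeasurable_funD.
  exists (~` positive); split => //; first exact: measurableC.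
  move=> y /=; apply: contra_not => y0 _; exact: trunc_step.
have : \int[pi]_y trunc N 0 y <=
    (\sum_(0 <= i < j) rho ^+ i * C)%:E + \int[pi]_y trunc N j y.
  elim: j => [|j IH]; first by rewrite big_geq// add0e.
  rewrite (le_trans IH)// big_nat_recr//= EFinD -addeA.
  by rewrite leeD2l// step.
move=> /le_trans; apply; rewrite leeD2r// lee_fin.
rewrite -mulr_suml mulrC ler_wpM2l// -[leRHS]mul1r ler_pdivlMr ?subr_gt0//.
rewrite big_mkord mulrC -[X in (X * _)%R]opprB mulNr -subrX1 opprB.
by rewrite gerBl exprn_ge0// ltW.
Qed.

Let trunc_le N : (0 <= N)%R -> \int[pi]_y trunc N 0 y <= (C / (1 - rho))%:E.
Proof.
move=> N0.
have rlim : (rho ^+ j)%R @[j --> \oo] --> (0 : R)%R.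
  by apply: cvg_expr; rewrite ger0_norm// ltW.
have lim : \int[pi]_y trunc N j y @[j --> \oo] --> 0.
  rewrite -(integral0 pi [set: rR]).
  apply: (@dominated_cvg _ _ _ _ _ measurableT _ (cst 0) (cst N%:E)) => //.
  - move=> y _; apply/cvg_EFin; first exact: nearW.
    apply: (@squeeze_cvgr _ _ _ _ (cst 0%R)
      (fun j => rho ^+ j * `|H x - H y|)%R).
    + by apply: nearW => j; rewrite /comp/= le_min N0 dist_ge0 ge_min lexx orbT.
    + exact: cvg_cst.
    + by rewrite -(mul0r `|H x - H y|%R); apply: cvgMl.
  - exact: finite_measure_integrable_cst.
  - by move=> j y _; rewrite gee0_abs ?trunc_ge0// lee_fin ge_min lexx.
have cv : (C / (1 - rho))%:E + \int[pi]_y trunc N j y @[j --> \oo] -->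
    (C / (1 - rho))%:E + 0.
  by apply: cvgeD => //; exact: cvg_cst.
rewrite -[leRHS]adde0 -(cvg_lim _ cv)//; apply: lime_ge.
  by apply/cvg_ex; eexists; exact: cv.
by apply: nearW => j; exact: trunc_iter.
Qed.

Let stationary_dist : \int[pi]_y `|H x - H y|%:E <= (C / (1 - rho))%:E.
Proof.
have cv : \int[pi]_y trunc N%:R 0 y @[N --> \oo] -->
    \int[pi]_y limn (fun N => trunc N%:R 0 y).
  apply: (@cvg_monotone_convergence _ _ _ pi _ measurableT
    (fun N => trunc N%:R 0)).
  - by move=> N; exact: mtrunc.
  - by move=> N y _; exact: trunc_ge0.
  - move=> y _ a b ab; rewrite lee_fin le_min !ge_min lexx orbT andbT.
    by rewrite ler_nat ab.
rewrite (_ : integral _ _ _ = \int[pi]_y limn (fun N => trunc N%:R 0 y)).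
  rewrite -(cvg_lim _ cv)//; apply: lime_le.
    by apply/cvg_ex; eexists; exact: cv.
  by apply: nearW => N; exact: trunc_le.
apply: eq_integral => y _; apply/esym/cvg_lim => //.
apply: cvg_near_cst; near=> N.
rewrite /trunc mul1r; congr EFin; apply/min_idPr.
by near: N; exact: nbhs_infty_ger.
Unshelve. all: by end_near. Qed.

(** Two copies driven by the same maps, one started at x and one in the
    stationary law, are rho-contracted in the potential distance; the last step
    converts that distance into the usual one, at the cost of A. *)
Theorem wasserstein_random_map (A : R) n : (0 <= A)%R ->
  (forall s t : R, (0 < s)%R -> (0 < t)%R ->
    \int[P]_w `|f (s, w) - f (t, w)|%:E <= (A * `|H s - H t|)%:E) ->
  wasserstein (kernel_iter k n.+1 x) pi <= (A * rho ^+ n * (C / (1 - rho)))%:E.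
Proof.
move=> A0 Hf.
have mHH : measurable_fun [set: rR * rR] (fun z : rR * rR => `|H z.1 - H z.2|%R).
  apply: measurableT_comp => //; apply: measurable_funB.
    exact: (measurableT_comp mH measurable_fst).
  exact: (measurableT_comp mH measurable_snd).
have mff : measurable_fun [set: rR * rR] (fun z : rR * rR => `|(z.1 : R) - z.2|%R).
  apply: measurableT_comp => //; apply: measurable_funB => //.
have dH : \int[coupled_chain n (x, x)]_z `|H z.1 - H z.2|%:E <=
    (rho ^+ n * (C / (1 - rho)))%:E.
  elim: n => [|n IH].
    rewrite mul1r (le_trans _ stationary_dist)// ge0_integral_random_map_kernel//.
    exact/measurable_EFinP.
  apply: (le_trans (@coupled_step_le n x _ (fun z : rR * rR => `|H z.1 - H z.2|)%R rho _ _ mHH _ mHH _ _)) => //.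
    exact: ltW.
  rewrite exprS -mulrA EFinM lee_wpmul2l// lee_fin ltW//.
apply: ereal_inf_le.
exists (\int[coupling_prob n.+1 x]_z `|(z.1 : R) - (z.2 : R)|%:E).
  exists (coupling_prob n.+1 x) => //; exact: coupling_probP.
rewrite (eq_measure_integral (coupled_chain n.+1 (x, x))); last first.
  by move=> B _ _; exact: coupling_probE.
apply: (le_trans (@coupled_step_le n x _ (fun z : rR * rR => `|H z.1 - H z.2|)%R A _ _ mff _ mHH _ _)) => //.
by rewrite -mulrA EFinM lee_wpmul2l// lee_fin.
Qed.

End contraction.

(** * The posterior is stationary for the Gibbs sampler *)

Section gibbs_stationarity.
Local Open Scope ereal_scope.
Context (R : realType) (J : nat) (Y : 'I_J -> R) (alpha beta K : R).
Hypotheses (hJ : (1 <= J)%N) (halpha : (0 < alpha)%R) (hK : (0 <= K)%R).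
Local Notation mu := (@lebesgue_measure R).
Local Notation rR := (measurableTypeR R).
Local Notation phi := (@normal_pdf R 0 1).
Local Notation m := (gibbs_shape J alpha).
Local Notation Yb := (gibbs_mean Y).
Local Notation S0 := (gibbs_Sigma0 Y beta).
Local Notation jd := (gibbs_joint_fun Y alpha beta K).
Implicit Types (h : rR -> \bar R) (s z g t w : R).
Hypothesis hS0 : (0 < S0)%R.

Let J_gt0 : (0 < J%:R :> R)%R. Proof. by rewrite ltr0n. Qed.

Let m_gt : (2^-1 < m)%R.
Proof.
rewrite /gibbs_shape -[ltLHS]add0r ltr_leD// -[leLHS]mul1r ler_wpM2r// ler1n//.
Qed.

Let m_gt0 : (0 < m)%R. Proof. by apply: lt_trans m_gt. Qed.

(** The rate of the Gamma law of s given theta, as a function of theta - Yb. *)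
Definition gibbs_rate w : R := (S0 + J%:R / 2 * w ^+ 2)%R.

(** theta - Yb, as resampled from s with the standard normal z. *)
Definition gibbs_shift s z : R :=
  (z / Num.sqrt (s * J%:R + K) - Yb * K / (s * J%:R + K))%R.

Lemma gibbs_mapE s z g :
  gibbs_map Y beta K (s, (z, g)) = (g / gibbs_rate (gibbs_shift s z))%R.
Proof. by []. Qed.

Lemma gibbs_rate_ge w : (S0 <= gibbs_rate w)%R.
Proof. by rewrite lerDl mulr_ge0 ?sqr_ge0// divr_ge0. Qed.

Lemma gibbs_rate_gt0 w : (0 < gibbs_rate w)%R.
Proof. exact: lt_le_trans (gibbs_rate_ge w). Qed.

Lemma measurable_gibbs_rate : measurable_fun [set: rR] gibbs_rate.
Proof.
by apply: measurable_funD => //; apply: measurable_funM => //.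
Qed.

Lemma sum_sqr_shift t :
  (\sum_j (Y j - t) ^+ 2 = \sum_j (Y j - Yb) ^+ 2 + J%:R * (t - Yb) ^+ 2)%R.
Proof.
have sumY : (\sum_j Y j = J%:R * Yb)%R.
  by rewrite /gibbs_mean mulrC divfK// gt_eqF.
rewrite (eq_bigr (fun j => (Y j - Yb) ^+ 2 +
   (- 2 * (t - Yb) * Y j + (t ^+ 2 - Yb ^+ 2)))%R); last by move=> j _; ring.
rewrite big_split/=; congr +%R.
rewrite big_split/= -mulr_sumr sumY sumr_const card_ord -mulr_natl.
by ring.
Qed.

Lemma gibbs_joint_funE t s :
  jd (t, s) = (expR (- (K * t ^+ 2 / 2)) * gamma_rate_fun m (gibbs_rate (t - Yb)) s)%R.
Proof.
rewrite /gibbs_joint_fun /gamma_rate_fun; case: ifPn => s0; last by rewrite mulr0.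
rewrite [RHS]mulrCA /gibbs_shape addrAC; congr (_ * _)%R.
rewrite -expRD; congr expR; rewrite sum_sqr_shift /gibbs_rate /gibbs_Sigma0.
by ring.
Qed.

Let prec s : R := (s * J%:R + K)%R.

Let prec_gt0 s : (0 < s)%R -> (0 < prec s)%R.
Proof. by move=> s0; rewrite ltr_wpDr// mulr_gt0. Qed.

Let marg s : R := (s `^ (m - 1) *
  expR (- (S0 * s) - K * (s * J%:R) * Yb ^+ 2 / (2 * prec s)))%R.

(** Completing the square: given s, theta is normal with mean
    Yb - Yb K / (J s + K) and variance 1 / (J s + K). *)
Lemma gibbs_joint_shift s z : (0 < s)%R ->
  (jd ((Num.sqrt (prec s))^-1 * z + (Yb - Yb * K / prec s), s) =
   marg s / normal_peak 1 * phi z)%R.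
Proof.
move=> s0; have p0 := prec_gt0 s0.
have r0 : (0 < Num.sqrt (prec s))%R by rewrite sqrtr_gt0.
have r2 : (Num.sqrt (prec s) ^+ 2 = prec s)%R by rewrite sqr_sqrtr// ltW.
rewrite gibbs_joint_funE /gamma_rate_fun s0 normal_pdf01E /marg.
rewrite [RHS]mulrA divfK ?lt0r_neq0 ?normal_peak_gt0 ?oner_neq0//.
rewrite -[RHS]mulrA -expRD [LHS]mulrCA -expRD; congr (_ * expR _)%R.
rewrite /gibbs_rate.
have -> (u : R) : ((S0 + J%:R / 2 * u ^+ 2) * s = S0 * s + (s * J%:R) * u ^+ 2 / 2)%R.
  by ring.
have -> : (s * J%:R = Num.sqrt (prec s) ^+ 2 - K)%R by rewrite r2 addrK.
move: (Num.sqrt (prec s)) r0 r2 => r r0 r2; rewrite -r2.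
by field; rewrite gt_eqF.
Qed.

Lemma integral_joint_theta s (k : rR -> \bar R) : (0 < s)%R ->
  measurable_fun [set: rR] k -> (forall t, 0 <= k t) ->
  \int[mu]_t ((jd (t, s))%:E * k (t - Yb)%R) =
  ((Num.sqrt (prec s))^-1 * (marg s / normal_peak 1))%:E *
  \int[normal_prob 0 1]_z k (gibbs_shift s z).
Proof.
move=> s0 mk k0.
have r0 : (0 < (Num.sqrt (prec s))^-1)%R by rewrite invr_gt0 sqrtr_gt0 prec_gt0.
have mshift : measurable_fun [set: rR] (fun z : rR => gibbs_shift s z).
  by apply: measurable_funD => //; exact: measurable_funM.
have mks : measurable_fun [set: rR] (fun z : rR => k (gibbs_shift s z)).
  exact: (measurableT_comp mk mshift).
pose f t : \bar R := (jd (t, s))%:E * k (t - Yb)%R.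
have mf : measurable_fun [set: rR] f.
  apply: emeasurable_funM.
    apply/measurable_EFinP.
    exact: (measurableT_comp (measurable_gibbs_joint_fun Y alpha beta K)
      (measurable_pair2 s)).
  by apply: (measurableT_comp mk); exact: measurable_funB.
have f0 t : 0 <= f t by rewrite mule_ge0 ?lee_fin ?gibbs_joint_fun_ge0.
have c0 : (0 <= marg s / normal_peak 1)%R.
  by rewrite divr_ge0 ?normal_peak_ge0// mulr_ge0 ?powR_ge0 ?expR_ge0.
rewrite (@integral_normal_prob R (fun z => k (gibbs_shift s z)))//.
rewrite -[LHS]/(\int[mu]_t f t).
rewrite (ge0_integral_affine (Yb - Yb * K / prec s)%R r0 mf f0) EFinM -muleA.
congr (_ * _).
have E : \int[mu]_z ((marg s / normal_peak 1)%:E * ((phi z)%:E * k (gibbs_shift s z))) =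
    (marg s / normal_peak 1)%:E * \int[mu]_z ((phi z)%:E * k (gibbs_shift s z)).
  apply: ge0_integralZl; rewrite // ?lee_fin//.
  - apply: emeasurable_funM => //; apply/measurable_EFinP.
    exact: measurable_normal_pdf.
  - by move=> z _; rewrite mule_ge0 ?lee_fin ?normal_pdf_ge0.
rewrite -E; apply: eq_integral => z _.
rewrite /f gibbs_joint_shift// muleA -EFinM; congr (_ * k _).
by rewrite /gibbs_shift -/(prec s); ring.
Qed.

Let normal_cst : \int[normal_prob 0 1]_z (cst (1 : \bar R) z) = 1 :> \bar R.
Proof. exact: integral_cst_probability. Qed.

Let G := fine (gamma_mass m).

Let G_gt0 : (0 < G)%R.
Proof. by rewrite fine_gt0// gamma_mass_gt0 gamma_mass_fin. Qed.

(** The law of s given theta = Yb + w, applied to h. *)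
Let kern h (w : rR) : \bar R :=
  \int[gamma_prob m]_g h (g / gibbs_rate w)%R.

Lemma integral_gibbs_noise s h :
  measurable_fun [set: rR] h -> (forall y, 0 <= h y) ->
  \int[gibbs_noise J alpha]_w h (gibbs_map Y beta K (s, w)) =
  \int[normal_prob 0 1]_z kern h (gibbs_shift s z).
Proof.
move=> mh h0; rewrite fubini_tonelli1//.
apply: (measurableT_comp mh).
exact: (measurableT_comp (measurable_gibbs_map Y beta K) (measurable_pair1 s)).
Qed.

Lemma measurable_kern h : measurable_fun [set: rR] h -> (forall y, 0 <= h y) ->
  measurable_fun [set: rR] (kern h).
Proof.
move=> mh h0.
apply: (@measurable_fun_fubini_tonelli_F _ _ rR rR R (gamma_prob m)
  (fun p => h (p.2 / gibbs_rate p.1)%R)) => //.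
apply: (measurableT_comp mh); apply: measurable_funM => //.
apply: (measurableT_comp (@measurable_invr R)).
exact: (measurableT_comp measurable_gibbs_rate).
Qed.

Lemma integral_joint_s t h :
  measurable_fun [set: rR] h -> (forall y, 0 <= h y) ->
  \int[mu]_s ((jd (t, s))%:E * h s) =
  (expR (- (K * t ^+ 2 / 2)) * gibbs_rate (t - Yb) `^ (- m) * G)%:E *
  kern h (t - Yb)%R.
Proof.
move=> mh h0.
have D0 := gibbs_rate_gt0 (t - Yb)%R.
have mhD : measurable_fun [set: rR] (fun g : rR => h (g / gibbs_rate (t - Yb))%R).
  by apply: (measurableT_comp mh); exact: measurable_funM.
rewrite /kern (integral_gamma_prob m_gt0 mhD)// (integral_gamma_rate m D0 mh h0).
rewrite !muleA -!EFinM -[in RHS]mulrA -/G.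
rewrite [X in _ = X%:E * _](_ : _ = expR (- (K * t ^+ 2 / 2)))%R; last first.
  by rewrite powRN; field; rewrite !gt_eqF// powR_gt0.
have mgh : measurable_fun [set: rR]
    (fun s : rR => (gamma_rate_fun m (gibbs_rate (t - Yb)) s)%:E * h s).
  apply: emeasurable_funM => //; apply/measurable_EFinP.
  exact: measurable_gamma_rate_fun.
have E : \int[mu]_s ((expR (- (K * t ^+ 2 / 2)))%:E *
    ((gamma_rate_fun m (gibbs_rate (t - Yb)) s)%:E * h s)) =
  (expR (- (K * t ^+ 2 / 2)))%:E *
  \int[mu]_s ((gamma_rate_fun m (gibbs_rate (t - Yb)) s)%:E * h s).
  apply: (ge0_integralZl mu measurableT mgh); rewrite // ?lee_fin ?expR_ge0//.
  by move=> s _; rewrite mule_ge0 ?lee_fin ?gamma_rate_fun_ge0.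
by rewrite -E; apply: eq_integral => s _; rewrite muleA -EFinM -gibbs_joint_funE.
Qed.

Let C := \int[mu \x mu]_p (jd p)%:E.

Let mjd : measurable_fun [set: rR * rR] (fun p => (jd p)%:E).
Proof. by apply/measurable_EFinP; exact: measurable_gibbs_joint_fun. Qed.

Let jd0 p : 0 <= (jd p)%:E.
Proof. by rewrite lee_fin gibbs_joint_fun_ge0. Qed.

Let C_gt0 : 0 < C.
Proof.
pose A : set (rR * rR) := `[0%R, 1%R]%classic `*` `[1%R, 2%R]%classic.
apply: (@integral_gt0 _ (rR * rR)%type R (mu \x mu) A jd).
- by apply: measurableX; exact: measurable_itv.
- have E : (mu \x mu)%E A = mu `[0%R, 1%R]%classic * mu `[1%R, 2%R]%classic.
    by apply: product_measure1E; exact: measurable_itv.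
  rewrite [ltRHS]E [X in X * _](lebesgue_measure_itv `[0%R, 1%R]).
  rewrite [X in _ * X](lebesgue_measure_itv `[1%R, 2%R])/=.
  rewrite !lte_fin ltr01 ltr1n/= -!EFinB -EFinM lte_fin.
  by rewrite mulr_gt0// subr_gt0 ltr1n.
- exact: measurable_gibbs_joint_fun.
- by move=> p; exact: gibbs_joint_fun_ge0.
- move=> [t s] [_] /=; rewrite in_itv/= => /andP[s1 _].
  have s0 : (0 < s)%R by exact: lt_le_trans s1.
  by rewrite s0 mulr_gt0 ?expR_gt0// powR_gt0.
Qed.

(* Integrating theta out leaves at most a constant times the Gamma density of
   shape m - 1/2 and rate Sigma0. *)
Let C_fin : C < +oo.
Proof.
rewrite /C fubini_tonelli2//.
pose c : R := ((Num.sqrt J%:R)^-1 / normal_peak 1)%R.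
have c0 : (0 <= c)%R by rewrite divr_ge0 ?normal_peak_ge0// invr_ge0.
have m2 : (0 < m - 2^-1)%R by rewrite subr_gt0.
apply: (@le_lt_trans _ _ (c%:E * \int[mu]_s (gamma_rate_fun (m - 2^-1) S0 s)%:E)).
  rewrite -ge0_integralZl//; last 2 first.
  - by apply/measurable_EFinP; exact: measurable_gamma_rate_fun.
  - by move=> s _; rewrite lee_fin gamma_rate_fun_ge0.
  apply: ge0_le_integral => //.
  - by move=> s _; apply: integral_ge0.
  - exact: measurable_fun_fubini_tonelli_G.
  - by apply: measurable_funeM; apply/measurable_EFinP; exact: measurable_gamma_rate_fun.
  move=> s _; rewrite /fubini_G.
  have [s0|s0] := ltP 0%R s; last first.
    rewrite integral0_eq ?mule_ge0 ?lee_fin ?gamma_rate_fun_ge0// => t _.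
    by rewrite gibbs_joint_funE /gamma_rate_fun ltNge s0 mulr0.
  under eq_integral do rewrite -[(jd _)%:E]mule1.
  have p0 := prec_gt0 s0.
  rewrite (@integral_joint_theta s (cst 1) s0)// normal_cst mule1 -EFinM lee_fin.
  rewrite /c mulrA [leRHS]mulrAC ler_wpM2r ?invr_ge0 ?normal_peak_ge0//.
  rewrite /gamma_rate_fun s0 /marg.
  have -> : (s `^ (m - 2^-1 - 1) = s `^ (m - 1) / Num.sqrt s)%R.
    rewrite -powR12_sqrt ?(ltW s0)// -powRN -powRD ?(gt_eqF s0) ?implybT//.
    by congr powR; ring.
  have sq : ((Num.sqrt (prec s))^-1 <= (Num.sqrt J%:R)^-1 * (Num.sqrt s)^-1)%R.
    rewrite -invfM lef_pV2 ?posrE ?mulr_gt0 ?sqrtr_gt0//.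
    by rewrite mulrC -sqrtrM ?(ltW s0)// ler_sqrt ?lerDl// ltW.
  have ex : (expR (- (S0 * s) - K * (s * J%:R) * Yb ^+ 2 / (2 * prec s)) <=
      expR (- (S0 * s)))%R.
    rewrite ler_expR gerDl oppr_le0 divr_ge0//.
      by rewrite mulr_ge0 ?sqr_ge0// mulr_ge0// mulr_ge0// ltW.
    by rewrite mulr_ge0// ltW.
  rewrite [leRHS](_ : _ = (Num.sqrt J%:R)^-1 * (Num.sqrt s)^-1 *
    (s `^ (m - 1) * expR (- (S0 * s))))%R; last by ring.
  apply: ler_pM => //.
    by rewrite mulr_ge0 ?powR_ge0 ?expR_ge0.
  by rewrite ler_wpM2l ?powR_ge0.
rewrite gamma_mass_rate//.
rewrite muleA -EFinM lte_mul_pinfty ?lee_fin ?mulr_ge0 ?powR_ge0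
  ?invr_ge0 ?normal_peak_ge0//.
exact: gamma_mass_fin.
Qed.

Lemma integral_gibbs_stationary h :
  measurable_fun [set: rR] h -> (forall y, 0 <= h y) ->
  \int[gibbs_stationary Y alpha beta K]_y h y =
  ((fine C)^-1)%:E * \int[mu \x mu]_p ((jd p)%:E * h p.2).
Proof.
move=> mh h0; rewrite ge0_integral_distribution//.
rewrite (ge0_integral_prob_propto _ _ C_gt0 C_fin)//; last first.
  by move=> p; exact: h0.
exact: (measurableT_comp mh measurable_snd).
Qed.

Local Arguments gibbs_joint_fun : simpl never.

(** Both sides are integrals against the joint density, and resampling either
    coordinate from its conditional law given the other leaves it unchanged:
    the normal conditional moves h o f to the Gamma kernel applied to h, which
    the Gamma conditional moves back to h. *)
Lemma gibbs_stationaryP h :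
  measurable_fun [set: rR] h -> (forall y, 0 <= h y) ->
  \int[gibbs_stationary Y alpha beta K]_y
    \int[gibbs_noise J alpha]_w h (gibbs_map Y beta K (y, w)) =
  \int[gibbs_stationary Y alpha beta K]_y h y.
Proof.
move=> mh h0.
pose U (s : rR) := \int[gibbs_noise J alpha]_w h (gibbs_map Y beta K (s, w)).
have U0 s : 0 <= U s by apply: integral_ge0.
have mU : measurable_fun [set: rR] U.
  apply: (@measurable_fun_fubini_tonelli_F _ _ rR _ R (gibbs_noise J alpha)
    (fun p => h (gibbs_map Y beta K p))) => //.
  apply: (measurableT_comp mh); exact: measurable_gibbs_map.
rewrite -/(U _) (integral_gibbs_stationary mU U0) (integral_gibbs_stationary mh h0).
congr (_ * _).
have mk := measurable_kern mh h0.
have k0 w : 0 <= kern h w by apply: integral_ge0.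
have mjU : measurable_fun [set: rR * rR] (fun p : rR * rR => (jd p)%:E * U p.2).
  by apply: emeasurable_funM => //; exact: (measurableT_comp mU measurable_snd).
have mjh : measurable_fun [set: rR * rR] (fun p : rR * rR => (jd p)%:E * h p.2).
  by apply: emeasurable_funM => //; exact: (measurableT_comp mh measurable_snd).
pose f (p : rR * rR) := (jd p)%:E * kern h (p.1 - Yb)%R.
have mf : measurable_fun [set: rR * rR] f.
  apply: emeasurable_funM => //; apply: (measurableT_comp mk).
  by apply: measurable_funB.
have f0 p : 0 <= f p by rewrite mule_ge0.
rewrite (fubini_tonelli2 (m1 := mu) (m2 := mu) _ mjU); last first.
  by move=> p; rewrite mule_ge0.
transitivity (\int[mu]_s \int[mu]_t f (t, s)).
  apply: eq_integral => s _; rewrite /fubini_G /f /=.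
  have [s0|s0] := ltP 0%R s; last first.
    have jd_0 t : jd (t, s) = 0%R.
      by rewrite gibbs_joint_funE /gamma_rate_fun ltNge s0 mulr0.
    by apply: eq_integral => t _; rewrite jd_0 !mul0e.
  rewrite (integral_joint_theta s0 mk k0).
  rewrite (integral_joint_theta (k := cst (U s)) s0)//.
    congr (_ * _); rewrite [LHS](integral_cst_probability _ (U s)).
    exact: integral_gibbs_noise.
  by move=> t; exact: U0.
rewrite -(fubini_tonelli f mf f0).
rewrite (fubini_tonelli1 (m1 := mu) (m2 := mu) _ mjh); last first.
  by move=> p; rewrite mule_ge0.
apply: eq_integral => t _; rewrite /fubini_F /f /=.
rewrite (integral_joint_s t mh h0).
rewrite (@integral_joint_s t (cst (kern h (t - Yb)%R)))//; last first.
  by move=> y; exact: k0.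
congr (_ * _); exact: (integral_cst_probability _ (kern h (t - Yb)%R)).
Qed.

End gibbs_stationarity.

(** * One-step estimates *)

Section integral_bounds.
Local Open Scope ereal_scope.
Context (R : realType).

Lemma ge0_integralZl_le d (T : measurableType d) (mu : {measure set T -> \bar R})
    (u : T -> R) (c a : R) : (0 <= c)%R ->
  measurable_fun [set: T] u -> (forall z, 0 <= u z)%R ->
  \int[mu]_z (u z)%:E <= a%:E -> \int[mu]_z (c * u z)%:E <= (c * a)%:E.
Proof.
move=> c0 mu' u0 ua; under eq_integral do rewrite EFinM.
rewrite ge0_integralZl ?lee_fin//.
- by rewrite EFinM lee_wpmul2l.
- exact/measurable_EFinP.
- by move=> z _; rewrite lee_fin.
Qed.

Lemma integral_cstD_le d (T : measurableType d) (P : probability T R)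
    (F u : T -> R) (c a : R) : (0 <= c)%R ->
  measurable_fun [set: T] F -> (forall z, 0 <= F z)%R ->
  measurable_fun [set: T] u -> (forall z, 0 <= u z)%R ->
  (forall z, F z <= c + u z)%R ->
  \int[P]_z (u z)%:E <= a%:E -> \int[P]_z (F z)%:E <= (c + a)%:E.
Proof.
move=> c0 mF F0 mu' u0 Fu ua.
apply: (@le_trans _ _ (\int[P]_z (c%:E + (u z)%:E))).
  apply: ge0_le_integral => //.
  - by move=> z _; rewrite lee_fin.
  - exact/measurable_EFinP.
  - by apply: emeasurable_funD => //; exact/measurable_EFinP.
  - by move=> z _; rewrite -EFinD lee_fin.
rewrite ge0_integralD//; last 2 first.
- by move=> z _; rewrite lee_fin.
- exact/measurable_EFinP.
by rewrite [X in X + _](integral_cst_probability P c%:E) EFinD leeD2l.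
Qed.

End integral_bounds.

Section gibbs_onestep.
Local Open Scope ereal_scope.
Context (R : realType) (J : nat) (Y : 'I_J -> R) (alpha beta K : R).
Hypotheses (hJ : (1 <= J)%N) (halpha : (0 < alpha)%R) (hK : (0 <= K)%R).
Local Notation rR := (measurableTypeR R).
Local Notation m := (gibbs_shape J alpha).
Local Notation Yb := (gibbs_mean Y).
Local Notation S0 := (gibbs_Sigma0 Y beta).
Local Notation rate := (gibbs_rate Y beta).
Local Notation shift := (gibbs_shift Y K).
Local Notation noise := (gibbs_noise J alpha).
Local Notation f := (gibbs_map Y beta K).
Implicit Types (s t x y z g : R).
Hypothesis hS0 : (0 < S0)%R.

Let J_gt0 : (0 < J%:R :> R)%R. Proof. by rewrite ltr0n. Qed.

Lemma gibbs_shape_gt0 : (0 < m)%R.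
Proof. by rewrite /gibbs_shape addr_gt0// divr_gt0. Qed.

Lemma gibbs_map_gt0 s : {ae noise, forall w, (0 < f (s, w))%R}.
Proof.
pose A : set (rR * rR) := [set w | (w.2 <= 0)%R].
have mA2 : measurable ([set g | (g <= 0)%R] : set rR).
  rewrite (_ : [set _ | _] = `]-oo, 0%R]%classic); first exact: measurable_itv.
  by apply/seteqP; split => g /=; rewrite in_itv.
have A2 : A = [set: rR] `*` [set g | (g <= 0)%R].
  by apply/seteqP; split => [w /= ?|w [_]].
exists A; split.
- by rewrite A2; exact: measurableX.
- rewrite A2; have E : gibbs_noise J alpha ([set: rR] `*` [set g : rR | (g <= 0)%R]) =
     normal_prob 0 1 [set: rR] * gamma_prob m [set g | (g <= 0)%R].
    exact: product_measure1E.
  rewrite E.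
  rewrite [X in _ * X](_ : _ = 0) ?mule0//.
  rewrite measure_integral_indic// integral_gamma_prob ?gibbs_shape_gt0//; last first.
    exact/measurable_EFinP/measurable_indic.
  rewrite integral0_eq ?mule0// => g _; rewrite indicE /gamma_fun.
  case: ifPn => g0; last by rewrite mul0e.
  by rewrite memNset ?mule0//= leNgt g0.
- move=> [z g] /=; apply: contra_notP; rewrite /A/= => /negP; rewrite -ltNge => g0.
  by apply: divr_gt0 => //; exact: gibbs_rate_gt0.
Qed.

(** The noise coordinates being independent, a bound u(Z) v(G) is integrated
    one factor at a time. *)
Lemma gibbs_noise_prod_le (F : rR * rR -> R) (u v : R -> R) (a b : R) :
  measurable_fun [set: rR * rR] F -> (forall w, 0 <= F w)%R ->
  measurable_fun [set: rR] u -> (forall z, 0 <= u z)%R ->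
  measurable_fun [set: rR] v -> (forall g, 0 <= v g)%R ->
  (forall z g, F (z, g) <= u z * v g)%R ->
  \int[normal_prob 0 1]_z (u z)%:E <= a%:E ->
  \int[gamma_prob m]_g (v g)%:E <= b%:E ->
  \int[noise]_w (F w)%:E <= (a * b)%:E.
Proof.
move=> mF F0 mu' u0 mv v0 Fle ua vb.
have mu1 : measurable_fun [set: rR] (EFin \o u) by exact/measurable_EFinP.
have mv1 : measurable_fun [set: rR] (EFin \o v) by exact/measurable_EFinP.
rewrite fubini_tonelli1; [|exact/measurable_EFinP|by move=> w; rewrite lee_fin].
have b0 : (0 <= b)%R.
  by rewrite -lee_fin (le_trans _ vb)// integral_ge0// => g _; rewrite lee_fin.
apply: (@le_trans _ _ (\int[normal_prob 0 1]_z (b%:E * (u z)%:E))).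
  apply: ge0_le_integral => //.
  - by move=> z _; apply: integral_ge0 => g _; rewrite lee_fin.
  - apply: measurable_fun_fubini_tonelli_F; first exact/measurable_EFinP.
    by move=> w; rewrite lee_fin.
  - exact: measurable_funeM.
  move=> z _; apply: (@le_trans _ _ (\int[gamma_prob m]_g ((u z)%:E * (v g)%:E))).
    apply: ge0_le_integral => //.
    - by move=> g _; rewrite lee_fin.
    - apply/measurable_EFinP; exact: (measurableT_comp mF (measurable_pair1 z)).
    - exact: measurable_funeM.
    - by move=> g _; rewrite -EFinM lee_fin.
  rewrite ge0_integralZl ?lee_fin//; last by move=> g _; rewrite lee_fin.
  by rewrite muleC lee_wpmul2r// lee_fin.
rewrite ge0_integralZl ?lee_fin//; last by move=> z _; rewrite lee_fin.
by rewrite mulrC EFinM lee_wpmul2l// lee_fin.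
Qed.

Lemma normal_mean_norm_le : \int[normal_prob 0 1]_z `|z|%:E <= 1%:E :> \bar R.
Proof.
apply: (@le_trans _ _ (\int[normal_prob 0 1]_z (2^-1%:E * (1%:E + (z ^+ 2)%:E)))).
  apply: ge0_le_integral => //.
  - by apply/measurable_EFinP; exact: normr_measurable.
  - apply: measurable_funeM; apply: emeasurable_funD => //.
    by apply/measurable_EFinP; exact: measurable_funX.
  move=> z _; rewrite -EFinD -EFinM lee_fin -real_normK ?num_real//.
  by have := sqr_ge0 (1 - `|z|)%R; lra.
have mX : measurable_fun [set: rR] (fun z : rR => (z ^+ 2)%:E : \bar R).
  by apply/measurable_EFinP; exact: measurable_funX.
rewrite ge0_integralZl//; last 2 first.
- exact: emeasurable_funD.
- by move=> z _; rewrite -EFinD lee_fin addr_ge0// sqr_ge0.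
rewrite ge0_integralD//; last by move=> z _; rewrite lee_fin sqr_ge0.
rewrite [X in X + _](integral_cst_probability _ 1%:E) normal_mean_sqr.
by rewrite -EFinD -EFinM lee_fin mulVf.
Qed.

Lemma normal_mean_affine_prod_le (a b : R) : (0 <= a)%R -> (0 <= b)%R ->
  \int[normal_prob 0 1]_z ((`|z| + a) * (`|z| + b))%:E <=
  ((1 + a) * (1 + b))%:E :> \bar R.
Proof.
move=> a0 b0.
have mX : measurable_fun [set: rR] (fun z : rR => (z ^+ 2)%:E : \bar R).
  by apply/measurable_EFinP; exact: measurable_funX.
have mN : measurable_fun [set: rR] (fun z : rR => `|z|%:E : \bar R).
  by apply/measurable_EFinP; exact: normr_measurable.
rewrite (_ : integral _ _ _ = \int[normal_prob 0 1]_z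
    ((z ^+ 2)%:E + ((a + b)%:E * `|z|%:E + (a * b)%:E))); last first.
  apply: eq_integral => z _; rewrite -!EFinM -!EFinD; congr EFin.
  by rewrite -(real_normK (num_real z)); ring.
have mL : measurable_fun [set: rR] (fun z : rR => (a + b)%:E * `|z|%:E).
  exact: measurable_funeM.
have L0 (z : rR) : 0 <= (a + b)%:E * `|z|%:E by rewrite -EFinM lee_fin mulr_ge0 ?addr_ge0.
have ab0 : 0 <= (a * b)%:E by rewrite lee_fin mulr_ge0.
rewrite ge0_integralD//; last 3 first.
- by move=> z _; rewrite lee_fin sqr_ge0.
- by move=> z _; rewrite adde_ge0.
- exact: emeasurable_funD.
rewrite ge0_integralD// ge0_integralZl//; last by rewrite lee_fin addr_ge0.
rewrite normal_mean_sqr [X in _ + (_ + X)](integral_cst_probability _ (a * b)%:E).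
rewrite (_ : ((1 + a) * (1 + b))%:E = 1%:E + ((a + b)%:E * 1%:E + (a * b)%:E)).
  by rewrite leeD2l// leeD2r// lee_wpmul2l ?lee_fin ?addr_ge0// normal_mean_norm_le.
by rewrite -EFinM -!EFinD; congr EFin; ring.
Qed.

Local Notation b := (Yb * K)%R.

(** The standard deviation of theta given s. *)
Definition gibbs_sd s : R := ((Num.sqrt (s * J%:R + K))^-1)%R.

Local Notation p := gibbs_sd.

Let prec_gt0 s : (0 < s)%R -> (0 < s * J%:R + K)%R.
Proof. by move=> s0; rewrite ltr_wpDr// mulr_gt0. Qed.

Lemma gibbs_sd_gt0 s : (0 < s)%R -> (0 < p s)%R.
Proof. by move=> s0; rewrite invr_gt0 sqrtr_gt0 prec_gt0. Qed.

Lemma gibbs_sd_sqr s : (0 < s)%R -> (p s ^+ 2 = (s * J%:R + K)^-1)%R.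
Proof. by move=> s0; rewrite exprVn sqr_sqrtr// ltW// prec_gt0. Qed.

Lemma gibbs_shift_sd s z : (0 < s)%R -> (shift s z = z * p s - b * p s ^+ 2)%R.
Proof. by move=> s0; rewrite gibbs_sd_sqr. Qed.

(** The bound of [gibbs_shift_sqdiff_le] averaged over Z, with the mean of
    (|Z| + u) (|Z| + v) replaced by its upper bound (1 + u) (1 + v). *)
Definition gibbs_sqdiff x y : R :=
  (`|p x ^+ 2 - p y ^+ 2| * ((1 + `|b| * (p x + p y)) *
    (1 + `|b| * ((p x ^+ 2 + p y ^+ 2) / (p x + p y)))))%R.

(** The squared shift is (z p - b p ^ 2) ^ 2; the difference of its values at u
    and v is a difference of squares, whose factors z (u - v) - b (u ^ 2 - v ^ 2)
    and z (u + v) - b (u ^ 2 + v ^ 2) yield u - v and u + v. *)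
Lemma gibbs_shift_sqdiff_le x y z : (0 < x)%R -> (0 < y)%R ->
  (`|shift x z ^+ 2 - shift y z ^+ 2| <=
   `|p x ^+ 2 - p y ^+ 2| * ((`|z| + `|b| * (p x + p y)) *
    (`|z| + `|b| * ((p x ^+ 2 + p y ^+ 2) / (p x + p y)))))%R.
Proof.
move=> x0 y0; rewrite !gibbs_shift_sd//.
have := gibbs_sd_gt0 x0; have := gibbs_sd_gt0 y0.
move: (p x) (p y) => u v v0 u0.
have uv0 : (0 < u + v)%R by rewrite addr_gt0.
rewrite [X in `|X|%R](_ : _ = (u ^+ 2 - v ^+ 2) * ((z - b * (u + v)) *
    (z - b * ((u ^+ 2 + v ^+ 2) / (u + v)))))%R; last first.
  by field; rewrite gt_eqF.
have w0 : (0 <= (u ^+ 2 + v ^+ 2) / (u + v))%R.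
  by rewrite divr_ge0 ?addr_ge0 ?sqr_ge0// ltW.
rewrite 2!normrM ler_wpM2l// ler_pM//.
  by rewrite (le_trans (ler_normB _ _))// lerD2l normrM (gtr0_norm uv0).
by rewrite (le_trans (ler_normB _ _))// lerD2l normrM (ger0_norm w0).
Qed.

Let mf s : measurable_fun [set: rR * rR] (fun w => f (s, w)).
Proof.
exact: (measurableT_comp (measurable_gibbs_map Y beta K) (measurable_pair1 s)).
Qed.

Let sqdiff_factor x y z : R :=
  (`|p x ^+ 2 - p y ^+ 2| * ((`|z| + `|b| * (p x + p y)) *
    (`|z| + `|b| * ((p x ^+ 2 + p y ^+ 2) / (p x + p y)))))%R.

Let sd_ge0 s : (0 <= p s)%R. Proof. by rewrite invr_ge0. Qed.

Let b_sum_ge0 x y : (0 <= `|b| * (p x + p y))%R.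
Proof. by rewrite mulr_ge0// addr_ge0. Qed.

Let b_mean_ge0 x y : (0 <= `|b| * ((p x ^+ 2 + p y ^+ 2) / (p x + p y)))%R.
Proof. by rewrite mulr_ge0// divr_ge0 ?addr_ge0 ?sqr_ge0. Qed.

Let sqdiff_factor_ge0 x y z : (0 <= sqdiff_factor x y z)%R.
Proof. by rewrite mulr_ge0// mulr_ge0 ?addr_ge0 ?normr_ge0 ?b_sum_ge0 ?b_mean_ge0. Qed.

Let msqdiff0 x y : measurable_fun [set: rR] (fun z : rR =>
  (`|z| + `|b| * (p x + p y)) *
    (`|z| + `|b| * ((p x ^+ 2 + p y ^+ 2) / (p x + p y))))%R.
Proof.
by apply: measurable_funM; apply: measurable_funD => //; exact: normr_measurable.
Qed.

Let msqdiff_factor x y : measurable_fun [set: rR] (sqdiff_factor x y).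
Proof. by apply: measurable_funM => //; exact: msqdiff0. Qed.

Let sqdiff_factor_mean x y :
  \int[normal_prob 0 1]_z (sqdiff_factor x y z)%:E <= (gibbs_sqdiff x y)%:E.
Proof.
rewrite /sqdiff_factor /gibbs_sqdiff.
apply: (@ge0_integralZl_le R _ rR _ (fun z => (`|z| + `|b| * (p x + p y)) *
    (`|z| + `|b| * ((p x ^+ 2 + p y ^+ 2) / (p x + p y))))%R) => //.
- by move=> z; rewrite mulr_ge0 ?addr_ge0 ?normr_ge0 ?b_sum_ge0 ?b_mean_ge0.
- exact: normal_mean_affine_prod_le (b_sum_ge0 _ _) (b_mean_ge0 _ _).
Qed.

(** 1 / f is affine in the squared shift, with slope J / (2 G). *)
Lemma gibbs_inv_diff_le x y : (1 < m)%R -> (0 < x)%R -> (0 < y)%R ->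
  \int[noise]_w `|(f (x, w))^-1 - (f (y, w))^-1|%:E <=
  (gibbs_sqdiff x y * (J%:R / 2 * (m - 1)^-1))%:E.
Proof.
move=> m1 x0 y0.
apply: (@gibbs_noise_prod_le _ (sqdiff_factor x y) (fun g => J%:R / 2 * `|g|^-1)%R).
- apply: measurable_normrB; apply: (measurableT_comp (@measurable_invr R)); exact: mf.
- by [].
- exact: msqdiff_factor.
- exact: sqdiff_factor_ge0.
- apply: measurable_funM => //; apply: (measurableT_comp (@measurable_invr R)).
  exact: normr_measurable.
- by move=> g; rewrite mulr_ge0 ?divr_ge0 ?invr_ge0.
- move=> z g; rewrite !gibbs_mapE !invf_div -mulrBl normrM normfV mulrA.
  rewrite ler_wpM2r ?invr_ge0// /gibbs_rate.
  rewrite (_ : (_ - _ = J%:R / 2 * (shift x z ^+ 2 - shift y z ^+ 2))%R); last by ring.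
  rewrite normrM ger0_norm ?divr_ge0// mulrC ler_wpM2r ?divr_ge0//.
  exact: gibbs_shift_sqdiff_le.
- exact: sqdiff_factor_mean.
- apply: ge0_integralZl_le.
  + by rewrite divr_ge0.
  + apply: (measurableT_comp (@measurable_invr R)); exact: normr_measurable.
  + by move=> g; rewrite invr_ge0.
  + by rewrite gamma_inv_mean.
Qed.

(** The two rates differ by J / 2 times the difference of the squared shifts,
    and each of them is at least Sigma0. *)
Lemma gibbs_diff_le x y : (0 < x)%R -> (0 < y)%R ->
  \int[noise]_w `|f (x, w) - f (y, w)|%:E <=
  (gibbs_sqdiff x y * (J%:R / 2 / S0 ^+ 2 * m))%:E.
Proof.
move=> x0 y0.
have c0 : (0 <= J%:R / 2 / S0 ^+ 2)%R by rewrite !divr_ge0 ?sqr_ge0.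
apply: (@gibbs_noise_prod_le _ (sqdiff_factor x y) (fun g => J%:R / 2 / S0 ^+ 2 * `|g|)%R).
- by apply: measurable_normrB; exact: mf.
- by [].
- exact: msqdiff_factor.
- exact: sqdiff_factor_ge0.
- by apply: measurable_funM => //; exact: normr_measurable.
- by move=> g; rewrite mulr_ge0.
- move=> z g; rewrite !gibbs_mapE.
  have Dx := gibbs_rate_gt0 hS0 (shift x z).
  have Dy := gibbs_rate_gt0 hS0 (shift y z).
  rewrite (_ : (_ - _ = (rate (shift x z) * rate (shift y z))^-1 * (J%:R / 2) *
     (- (shift x z ^+ 2 - shift y z ^+ 2)) * g)%R); last first.
    have E : (J%:R / 2 * - (shift x z ^+ 2 - shift y z ^+ 2) =
        rate (shift y z) - rate (shift x z))%R by rewrite /gibbs_rate; ring.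
    rewrite -(mulrA _ (J%:R / 2)%R) E.
    by field; rewrite (gt_eqF Dx) (gt_eqF Dy).
  rewrite normrM [leRHS]mulrA ler_wpM2r// normrM normrN mulrC.
  apply: ler_pM => //; first exact: gibbs_shift_sqdiff_le.
  rewrite ger0_norm; last by rewrite mulr_ge0 ?divr_ge0// invr_ge0 mulr_ge0// ltW.
  rewrite mulrC ler_wpM2l ?divr_ge0// lef_pV2 ?posrE ?exprn_gt0 ?mulr_gt0//.
  by rewrite expr2 ler_pM ?(ltW hS0)// gibbs_rate_ge.
- exact: sqdiff_factor_mean.
- apply: (@ge0_integralZl_le R _ rR _ (fun g => `|g|%R)) => //; first exact: normr_measurable.
  by rewrite gamma_mean// gibbs_shape_gt0.
Qed.

Lemma gibbs_start_le x : (0 < x)%R ->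
  \int[noise]_w `|x - f (x, w)|%:E <= (x + m / S0)%:E.
Proof.
move=> x0; apply: (@integral_cstD_le R _ _ noise _ (fun w => `|f (x, w)|%R)).
- exact: ltW.
- by apply: measurable_normrB => //; exact: mf.
- by [].
- by apply: measurableT_comp; [exact: normr_measurable|exact: mf].
- by [].
- by move=> w; rewrite (le_trans (ler_normB _ _))// gtr0_norm.
rewrite -[X in X%:E]mul1r.
apply: (@gibbs_noise_prod_le _ (cst 1%R) (fun g => S0^-1 * `|g|)%R) => //.
- by apply: measurableT_comp; [exact: normr_measurable|exact: mf].
- by apply: measurable_funM => //; exact: normr_measurable.
- by move=> g; rewrite mulr_ge0// invr_ge0 ltW.
- move=> z g; rewrite mul1r gibbs_mapE normrM mulrC ler_wpM2r//.
  rewrite normfV gtr0_norm ?gibbs_rate_gt0// lef_pV2 ?posrE ?gibbs_rate_gt0//.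
  exact: gibbs_rate_ge.
- by rewrite (integral_cst_probability _ 1%:E).
- rewrite mulrC; apply: (@ge0_integralZl_le R _ rR _ (fun g => `|g|%R)) => //.
  + by rewrite invr_ge0 ltW.
  + exact: normr_measurable.
  + by rewrite gamma_mean// gibbs_shape_gt0.
Qed.

(** Uses (z p - b p ^ 2) ^ 2 <= 2 (z p) ^ 2 + 2 (b p ^ 2) ^ 2. *)
Lemma gibbs_inv_start_le x : (1 < m)%R -> (0 < x)%R ->
  \int[noise]_w `|x^-1 - (f (x, w))^-1|%:E <=
  (x^-1 + (S0 + J%:R * (p x ^+ 2 + (b * p x ^+ 2) ^+ 2)) * (m - 1)^-1)%:E.
Proof.
move=> m1 x0.
have minvf : measurable_fun [set: rR * rR] (fun w => (f (x, w))^-1)%R.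
  by apply: (measurableT_comp (@measurable_invr R)); exact: mf.
apply: (@integral_cstD_le R _ _ noise _ (fun w => `|(f (x, w))^-1|%R)).
- by rewrite invr_ge0 ltW.
- exact: measurable_normrB.
- by [].
- by apply: measurableT_comp; [exact: normr_measurable|].
- by [].
- by move=> w; rewrite (le_trans (ler_normB _ _))// ger0_norm// invr_ge0 ltW.
pose u z : R := (S0 + J%:R * (b * p x ^+ 2) ^+ 2 + J%:R * p x ^+ 2 * z ^+ 2)%R.
have mz2 : measurable_fun [set: rR] (fun z : rR => z ^+ 2)%R by exact: measurable_funX.
have a0 : (0 <= S0 + J%:R * (b * p x ^+ 2) ^+ 2)%R.
  by rewrite addr_ge0 ?(ltW hS0)// mulr_ge0 ?sqr_ge0.
have c0 : (0 <= J%:R * p x ^+ 2)%R by rewrite mulr_ge0 ?sqr_ge0.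
have mz3 : measurable_fun [set: rR] (fun z : rR => J%:R * p x ^+ 2 * z ^+ 2)%R.
  exact: measurable_funM.
have u0 z : (0 <= u z)%R.
  by apply: addr_ge0 => //; apply: mulr_ge0 => //; exact: sqr_ge0.
have mu' : measurable_fun [set: rR] u by exact: measurable_funD.
apply: (@gibbs_noise_prod_le _ u (fun g => `|g|^-1)%R) => //.
- by apply: measurableT_comp; [exact: normr_measurable|].
- by apply: (measurableT_comp (@measurable_invr R)); exact: normr_measurable.
- move=> z g; rewrite gibbs_mapE invf_div normrM normfV ler_wpM2r ?invr_ge0//.
  rewrite gtr0_norm ?gibbs_rate_gt0// /gibbs_rate /u gibbs_shift_sd//.
  rewrite -!addrA lerD2l -subr_ge0.
  rewrite (_ : (_ - _ = J%:R / 2 * (z * p x + b * p x ^+ 2) ^+ 2)%R); last by field.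
  by rewrite mulr_ge0 ?sqr_ge0// divr_ge0.
- rewrite (_ : (S0 + _ = S0 + J%:R * (b * p x ^+ 2) ^+ 2 + J%:R * p x ^+ 2 * 1)%R); last by ring.
  apply: (@integral_cstD_le R _ rR _ _ (fun z => J%:R * p x ^+ 2 * z ^+ 2)%R) => //.
    by move=> z; rewrite mulr_ge0 ?sqr_ge0.
  apply: (@ge0_integralZl_le R _ rR _ (fun z => z ^+ 2)%R) => //.
    by move=> z; exact: sqr_ge0.
  by rewrite normal_mean_sqr.
- by rewrite gamma_inv_mean.
Qed.

End gibbs_onestep.

(** * The three potentials *)

Section sqdiff_bounds.
Context (R : realType) (J : nat) (Y : 'I_J -> R) (K : R).
Hypotheses (hJ : (1 <= J)%N) (hK : 0 <= K).
Local Notation Yb := (gibbs_mean Y).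
Local Notation b := (Yb * K).
Local Notation p := (gibbs_sd J K).
Local Notation a := (`|Yb| * Num.sqrt K).
Implicit Types (s x y : R).

Let J_gt0 : (0 : R) < J%:R. Proof. by rewrite ltr0n. Qed.

Let prec_gt0 s : 0 < s -> 0 < s * J%:R + K.
Proof. by move=> s0; rewrite ltr_wpDr// mulr_gt0. Qed.

Let b_sd_le s : 0 < s -> `|b| * p s <= a.
Proof.
move=> s0; rewrite normrM (ger0_norm hK) -mulrA ler_wpM2l//.
rewrite ler_pdivrMr ?sqrtr_gt0 ?prec_gt0// -[leLHS](sqr_sqrtr hK) expr2.
by rewrite ler_wpM2l// ler_wsqrtr// lerDr mulr_ge0// ltW.
Qed.

(** As p sqrt K <= 1, both |b| p x and |b| p y are at most |Yb| sqrt K; and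
    (u ^ 2 + v ^ 2) / (u + v) is a weighted mean of u and v. *)
Lemma gibbs_sqdiff_le x y : 0 < x -> 0 < y ->
  gibbs_sqdiff Y K x y <=
  `|p x ^+ 2 - p y ^+ 2| * (2 * ((a + 1) * (a + 2^-1))).
Proof.
move=> x0 y0; have px := gibbs_sd_gt0 hJ hK x0; have py := gibbs_sd_gt0 hJ hK y0.
have bx := b_sd_le x0; have by' := b_sd_le y0.
have pxy : 0 < p x + p y by exact: addr_gt0.
rewrite /gibbs_sqdiff ler_wpM2l//.
have -> : 2 * ((a + 1) * (a + 2^-1)) = (1 + (a + a)) * (1 + a) by field.
apply: ler_pM.
- by rewrite addr_ge0// mulr_ge0// ltW.
- by rewrite addr_ge0// mulr_ge0// divr_ge0 ?addr_ge0 ?sqr_ge0// ltW.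
- by rewrite lerD2l mulrDr lerD.
- rewrite lerD2l mulrA ler_pdivrMr// mulrDr mulrDr !expr2 !mulrA.
  by apply: lerD; rewrite ler_wpM2r// ltW.
Qed.

Lemma gibbs_sd_sqr_diff x y : 0 < x -> 0 < y ->
  `|p x ^+ 2 - p y ^+ 2| =
  J%:R * `|x - y| / ((x * J%:R + K) * (y * J%:R + K)).
Proof.
move=> x0 y0; have qx := prec_gt0 x0; have qy := prec_gt0 y0.
rewrite !gibbs_sd_sqr//.
rewrite (_ : _ - _ = J%:R * (y - x) / ((x * J%:R + K) * (y * J%:R + K))); last first.
  by field; rewrite (gt_eqF qx) (gt_eqF qy).
by rewrite normrM normfV normrM (gtr0_norm J_gt0) (gtr0_norm (mulr_gt0 qx qy)) distrC.
Qed.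

(** The left-hand side is J |x - y| / ((J x + K) (J y + K)), and J s + K >= J s. *)
Lemma gibbs_sd_sqr_diff_inv x y : 0 < x -> 0 < y ->
  `|p x ^+ 2 - p y ^+ 2| <= J%:R^-1 * `|x^-1 - y^-1|.
Proof.
move=> x0 y0; rewrite gibbs_sd_sqr_diff//.
rewrite (_ : x^-1 - y^-1 = (y - x) / (x * y)); last by field; rewrite !gt_eqF.
rewrite normrM normfV (gtr0_norm (mulr_gt0 x0 y0)) distrC.
rewrite ler_pdivrMr ?mulr_gt0 ?prec_gt0//.
rewrite [leRHS](_ : _ = `|y - x| * ((x * J%:R + K) * (y * J%:R + K) / (J%:R * (x * y))));
  last by field; rewrite !gt_eqF.
rewrite mulrC ler_wpM2l// ler_pdivlMr ?mulr_gt0//.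
rewrite [leLHS](_ : _ = (x * J%:R) * (y * J%:R)); last by ring.
by apply: ler_pM; rewrite ?lerDl// mulr_ge0// ltW.
Qed.

End sqdiff_bounds.

Section sqdiff_bounds1.
Context (R : realType) (J : nat) (Y : 'I_J -> R).
Hypotheses (hJ : (1 <= J)%N).
Local Notation Yb := (gibbs_mean Y).
Local Notation p := (gibbs_sd J (1 : R)).
Implicit Types (s x y : R).

Let J_gt0 : (0 : R) < J%:R. Proof. by rewrite ltr0n. Qed.

Let prec_ge1 s : 0 <= s -> 1 <= s * J%:R + 1.
Proof. by move=> s0; rewrite lerDr mulr_ge0. Qed.

Let prec_gt0 s : 0 <= s -> 0 < s * J%:R + 1.
Proof. by move=> s0; apply: lt_le_trans (prec_ge1 s0). Qed.

(** The left-hand side is J |x - y| / ((J x + 1) (J y + 1)), and J s + 1 >= 1. *)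
Lemma gibbs_sd_sqr_diff1 x y : 0 < x -> 0 < y ->
  `|p x ^+ 2 - p y ^+ 2| <= J%:R * `|x - y|.
Proof.
move=> x0 y0; rewrite gibbs_sd_sqr_diff//.
have qx := prec_ge1 (ltW x0); have qy := prec_ge1 (ltW y0).
rewrite ler_pdivrMr; last by rewrite mulr_gt0// (lt_le_trans ltr01).
by rewrite ler_peMr ?mulr_ge0// mulr_ege1.
Qed.

(** In terms of p = 1 / sqrt (J s + 1), the difference of the values at x and y
    is sqrt (2 / pi) (ln (p y / p x) + 2 |Yb| (p y - p x)): twice the bound of
    [normal_prob_scale_itv], which is why it contracts.  The absolute value
    makes the potential continuous on the whole line. *)
Definition gibbs_pot s : R :=
  (ln (`|s| * J%:R + 1) - 4 * `|Yb| / Num.sqrt (`|s| * J%:R + 1))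
    / Num.sqrt (2 * pi).

Let sqrt2pi_gt0 : 0 < Num.sqrt (2 * pi) :> R.
Proof. by rewrite sqrtr_gt0 mulr_gt0 ?pi_gt0. Qed.

Lemma gibbs_sd1_gt0 s : 0 <= s -> 0 < p s.
Proof. by move=> s0; rewrite invr_gt0 sqrtr_gt0 prec_gt0. Qed.

Lemma gibbs_sd1_le1 s : 0 <= s -> p s <= 1.
Proof.
move=> s0; rewrite invf_le1 ?sqrtr_gt0 ?prec_gt0//.
by rewrite -[leLHS]sqrtr1 ler_wsqrtr// prec_ge1.
Qed.

Lemma gibbs_sd1_sqr s : 0 <= s -> s * J%:R + 1 = (p s ^+ 2)^-1.
Proof. by move=> s0; rewrite exprVn invrK sqr_sqrtr// ltW// prec_gt0. Qed.

Lemma gibbs_potE s : 0 <= s ->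
  gibbs_pot s = (- (2 * ln (p s)) - 4 * `|Yb| * p s) / Num.sqrt (2 * pi).
Proof.
move=> s0; rewrite /gibbs_pot ger0_norm//; congr ((_ - _) / _).
rewrite gibbs_sd1_sqr// lnV ?posrE ?exprn_gt0 ?gibbs_sd1_gt0//.
by rewrite lnXn ?gibbs_sd1_gt0// mulr_natl.
Qed.

Lemma gibbs_sd1_le s t : 0 <= s -> s <= t -> p t <= p s.
Proof.
move=> s0 st; have t0 : 0 <= t by exact: le_trans st.
rewrite lef_pV2 ?posrE ?sqrtr_gt0 ?prec_gt0// ler_wsqrtr// lerD2r.
by rewrite ler_wpM2r.
Qed.

Lemma gibbs_pot_diff s t : 0 <= s -> 0 <= t ->
  gibbs_pot s - gibbs_pot t =
  (2 * (ln (p t) - ln (p s)) + 4 * `|Yb| * (p t - p s)) / Num.sqrt (2 * pi).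
Proof. by move=> s0 t0; rewrite !gibbs_potE// -mulrBl; congr (_ / _); ring. Qed.

Lemma gibbs_pot_lt s t : 0 <= s -> s < t -> gibbs_pot s < gibbs_pot t.
Proof.
move=> s0 st; have t0 : 0 <= t by exact: le_trans (ltW st).
rewrite -subr_gt0 gibbs_pot_diff// divr_gt0//.
have pts : p t < p s.
  rewrite ltf_pV2 ?posrE ?sqrtr_gt0 ?prec_gt0// ltr_sqrt ?prec_gt0//.
  by rewrite ltrD2r ltr_pM2r.
apply: ltr_wpDr; first by rewrite mulr_ge0// subr_ge0 ltW.
by rewrite mulr_gt0// subr_gt0 ltr_ln ?posrE ?gibbs_sd1_gt0.
Qed.

Lemma gibbs_pot_le s t : 0 <= s -> s <= t -> gibbs_pot s <= gibbs_pot t.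
Proof.
move=> s0; rewrite le_eqVlt => /predU1P[->//|st].
exact/ltW/gibbs_pot_lt.
Qed.

Lemma gibbs_pot_dist x y : 0 <= x -> 0 <= y -> p y <= p x ->
  `|gibbs_pot x - gibbs_pot y| =
  (2 * (ln (p x) - ln (p y)) + 4 * `|Yb| * (p x - p y)) / Num.sqrt (2 * pi).
Proof.
move=> x0 y0 pxy; rewrite distrC gibbs_pot_diff// ger0_norm// divr_ge0//.
have l0 : ln (p y) <= ln (p x) by rewrite ler_ln ?posrE ?gibbs_sd1_gt0.
by rewrite addr_ge0 ?mulr_ge0 ?subr_ge0.
Qed.

Lemma continuous_gibbs_pot : continuous gibbs_pot.
Proof.
move=> s.
have q0 (r : R) : 0 < `|r| * J%:R + 1 by exact: prec_gt0.
have cq : {for s, continuous (fun r : R => `|r| * J%:R + 1)}.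
  apply: continuousD; last exact: cvg_cst.
  by apply: continuousM; [exact: norm_continuous|exact: cvg_cst].
apply: (@continuousM _ _ (fun r : R => ln (`|r| * J%:R + 1) -
  4 * `|Yb| / Num.sqrt (`|r| * J%:R + 1)) (fun=> (Num.sqrt (2 * pi))^-1));
  last exact: cvg_cst.
apply: continuousB.
  apply: (@continuous_comp _ _ _ (fun r : R => `|r| * J%:R + 1) (@ln R)) => //.
  exact: continuous_ln.
apply: continuousM; first exact: cvg_cst.
apply: continuousV; first by rewrite gt_eqF// sqrtr_gt0.
apply: (@continuous_comp _ _ _ (fun r : R => `|r| * J%:R + 1) Num.sqrt) => //.
exact: sqrt_continuous.
Qed.

(** Both 2 ln (u / v) and 2 (u - v) are at most 1 / v ^ 2 - 1 / u ^ 2, which is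
    J (y - x), for u = p x >= v = p y in (0, 1]. *)
Lemma gibbs_pot_lipschitz x y : 0 <= x -> 0 <= y ->
  `|gibbs_pot x - gibbs_pot y| <=
  J%:R * (2 * `|Yb| + 1) / Num.sqrt (2 * pi) * `|x - y|.
Proof.
move=> x0 y0; wlog xy : x y x0 y0 / x <= y.
  move=> W; have [|/ltW yx] := leP x y; first exact: W.
  by rewrite distrC (distrC x); exact: W.
rewrite gibbs_pot_dist ?gibbs_sd1_le// distrC (ger0_norm (_ : 0 <= y - x)) ?subr_ge0//.
rewrite [leRHS]mulrAC ler_pM2r ?invr_gt0//.
have u0 := gibbs_sd1_gt0 x0; have v0 := gibbs_sd1_gt0 y0.
have u1 := gibbs_sd1_le1 x0; have v1 := gibbs_sd1_le1 y0.
have vu := gibbs_sd1_le x0 xy.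
have d0 : 0 <= p x - p y by rewrite subr_ge0.
have Jd : J%:R * (y - x) = (p y ^+ 2)^-1 - (p x ^+ 2)^-1.
  by rewrite -!gibbs_sd1_sqr//; ring.
have l1 : 2 * (ln (p x) - ln (p y)) <= J%:R * (y - x).
  have E : 2 * (ln (p x) - ln (p y)) = ln ((p x / p y) ^+ 2).
    by rewrite lnXn ?divr_gt0// ln_div ?posrE// mulr2n; ring.
  have z0 : 0 < (p x / p y) ^+ 2 by rewrite exprn_gt0// divr_gt0.
  have := le_ln1Dx (x := (p x / p y) ^+ 2 - 1).
  rewrite ltrBrDl subrr => /(_ z0); rewrite addrC subrK -E => l1.
  apply: (le_trans l1); rewrite Jd.
  rewrite (_ : _ - 1 = p x ^+ 2 * ((p y ^+ 2)^-1 - (p x ^+ 2)^-1)); last first.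
    by field; rewrite (gt_eqF u0) (gt_eqF v0).
  rewrite ler_piMl ?exprn_ile1 ?(ltW u0)// subr_ge0 lef_pV2 ?posrE ?exprn_gt0//.
  by rewrite ler_sqr ?nnegrE ?(ltW u0) ?(ltW v0).
have l2 : 2 * (p x - p y) <= J%:R * (y - x).
  rewrite Jd [leRHS](_ : _ = (p x - p y) * ((p x + p y) / (p x * p y) ^+ 2)); last first.
    by field; rewrite (gt_eqF u0) (gt_eqF v0).
  rewrite mulrC ler_wpM2l// ler_pdivlMr ?exprn_gt0 ?mulr_gt0//.
  have w1 : (p x * p y) ^+ 2 <= p x.
    rewrite expr2 -[leRHS]mulr1 -mulrA ler_wpM2l ?(ltW u0)//.
    by rewrite !mulr_ile1 ?mulr_ge0 ?(ltW u0) ?(ltW v0)// mulr_ile1 ?(ltW u0) ?(ltW v0).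
  have w2 : (p x * p y) ^+ 2 <= p y.
    rewrite mulrC expr2 -[leRHS]mulr1 -mulrA ler_wpM2l ?(ltW v0)//.
    by rewrite !mulr_ile1 ?mulr_ge0 ?(ltW u0) ?(ltW v0)// mulr_ile1 ?(ltW u0) ?(ltW v0).
  by rewrite mulr_natl mulr2n lerD.
rewrite (_ : J%:R * _ * _ = J%:R * (y - x) + 2 * `|Yb| * (J%:R * (y - x))); last by ring.
rewrite lerD// (_ : 4 * _ * _ = 2 * `|Yb| * (2 * (p x - p y))); last by ring.
by rewrite ler_wpM2l// mulr_ge0.
Qed.

(** With u = p x >= v = p y, both in (0, 1], expanding the left-hand side in
    powers of |Yb| leaves terms bounded either by 4 (u - v) or, through
    u ^ 2 - v ^ 2 <= 2 ln (u / v), by the logarithmic part of the potential. *)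
Lemma gibbs_sqdiff_le_pot x y : 0 < x -> 0 < y ->
  gibbs_sqdiff Y 1 x y <=
  (`|Yb| + 1) * Num.sqrt (2 * pi) * `|gibbs_pot x - gibbs_pot y|.
Proof.
move=> x0 y0; wlog pxy : x y x0 y0 / p y <= p x.
  move=> W; have [|/ltW pyx] := leP (p y) (p x); first exact: W.
  have := W y x y0 x0 pyx; rewrite distrC /gibbs_sqdiff [`|_ ^+ 2 - _|]distrC.
  by rewrite (addrC (p y)) (addrC (p y ^+ 2)).
rewrite (gibbs_pot_dist (ltW x0) (ltW y0) pxy).
rewrite [leRHS](_ : _ = (`|Yb| + 1) * (2 * (ln (p x) - ln (p y)) +
   4 * `|Yb| * (p x - p y))); last by field; rewrite gt_eqF.
rewrite /gibbs_sqdiff mulr1.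
have px := gibbs_sd1_gt0 (ltW x0); have py := gibbs_sd1_gt0 (ltW y0).
have px1 := gibbs_sd1_le1 (ltW x0).
have lnle : p x ^+ 2 - p y ^+ 2 <= 2 * (ln (p x) - ln (p y)).
  have E : 2 * (ln (p x) - ln (p y)) = - ln ((p y / p x) ^+ 2).
    by rewrite lnXn ?divr_gt0// ln_div ?posrE// mulr2n; ring.
  have z0 : 0 < (p y / p x) ^+ 2 by rewrite exprn_gt0// divr_gt0.
  have := le_ln1Dx (x := (p y / p x) ^+ 2 - 1).
  rewrite ltrBrDl subrr => /(_ z0); rewrite addrC subrK E => l1.
  apply: (@le_trans _ _ (1 - (p y / p x) ^+ 2)); last by lra.
  rewrite (_ : _ - _ = p x ^+ 2 * (1 - (p y / p x) ^+ 2)); last first.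
    by field; rewrite gt_eqF.
  have zge0 : 0 <= p y / p x by rewrite divr_ge0 ?(ltW px) ?(ltW py).
  have z1 : p y / p x <= 1 by rewrite ler_pdivrMr// mul1r.
  by rewrite ler_piMl ?exprn_ile1 ?(ltW px)// subr_ge0 exprn_ile1.
move: px py px1 pxy lnle; move: (p x) (p y) (ln _ - ln _) (normr_ge0 Yb).
move: `|Yb| => B u v L B0 u0 v0 u1 vu Luv.
have v1 : v <= 1 by exact: le_trans u1.
have uv0 : 0 <= u - v by rewrite subr_ge0.
rewrite ger0_norm; last by rewrite subr_sqr mulr_ge0// addr_ge0// ltW.
rewrite [leLHS](_ : _ = (u ^+ 2 - v ^+ 2) + B * ((u - v) * (u + v) ^+ 2) +
   B * ((u - v) * (u ^+ 2 + v ^+ 2)) + B ^+ 2 * ((u - v) * ((u + v) * (u ^+ 2 + v ^+ 2)))); last first.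
  by field; rewrite gt_eqF// addr_gt0.
have s2 : u + v <= 2 by lra.
have sq1 : (u + v) ^+ 2 <= 4.
  rewrite -subr_ge0 (_ : 4 - _ = (2 - (u + v)) * (2 + (u + v))); last by ring.
  by rewrite mulr_ge0//; lra.
have sq2 : u ^+ 2 + v ^+ 2 <= u + v.
  by rewrite lerD// expr2 ler_piMr// ltW.
have sq3 : (u + v) * (u ^+ 2 + v ^+ 2) <= 4.
  rewrite (le_trans _ sq1)// expr2 ler_wpM2l// addr_ge0// ltW//.
have t1 : B * ((u - v) * (u + v) ^+ 2) <= B * ((u - v) * 4).
  by rewrite ler_wpM2l// ler_wpM2l.
have t2 : B * ((u - v) * (u ^+ 2 + v ^+ 2)) <= B * (2 * L).
  rewrite ler_wpM2l// (le_trans _ Luv)// subr_sqr ler_wpM2l//.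
have t3 : B ^+ 2 * ((u - v) * ((u + v) * (u ^+ 2 + v ^+ 2))) <= B ^+ 2 * ((u - v) * 4).
  by rewrite ler_wpM2l ?sqr_ge0// ler_wpM2l.
rewrite [leRHS](_ : _ = 2 * L + B * ((u - v) * 4) + B * (2 * L) + B ^+ 2 * ((u - v) * 4)); last by ring.
by rewrite !lerD.
Qed.

End sqdiff_bounds1.

(** * Contraction of the logarithmic potential *)

Section normal_interval.
Local Open Scope ereal_scope.
Context (R : realType).
Local Notation mu := (@lebesgue_measure R).
Local Notation rR := (measurableTypeR R).
Local Notation phi := (@normal_pdf R 0 1).
Implicit Types (u v w b p : R).

Let cdf u : R := (\int[mu]_(t in `]-oo, u]) phi t)%R.

Let cdf_derive u : is_derive u 1%R cdf (phi u).
Proof.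
have int : mu.-integrable `]-oo, (u + 1)%R] (EFin \o phi).
  apply: (integrableS measurableT) => //; exact: integrable_normal_pdf.
have [] := @continuous_FTC1 R phi -oo%O u (u + 1)%R _ int _ _.
- by rewrite ltrDl.
- by rewrite ltNyr.
- by apply: continuous_normal_pdf; rewrite oner_eq0.
by move=> d1 d2; apply: DeriveDef; [exact: d1|rewrite -derive1E; exact: d2].
Qed.

Let cdfE u : normal_prob 0 1 `]-oo, u]%classic = (cdf u)%:E.
Proof.
rewrite /cdf /Rintegral fineK//.
have fin := fin_num_measure (normal_prob 0 1 : probability rR R) `]-oo, u]%classic.
by apply: fin; exact: measurable_itv.
Qed.

Let normal_prob_itv u v : (u <= v)%R ->
  normal_prob 0 1 `[u, v]%classic = (cdf v - cdf u)%:E.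
Proof.
move=> uv.
have -> : normal_prob 0 1 `[u, v]%classic = normal_prob 0 1 `]u, v]%classic.
  rewrite /normal_prob -integral_itv_obnd_cbnd//.
  apply/measurable_EFinP; apply: measurable_funTS; exact: measurable_normal_pdf.
have U : `]-oo, v]%classic = `]-oo, u]%classic `|` `]u, v]%classic :> set rR.
  by rewrite -itv_bndbnd_setU.
have E : normal_prob 0 1 (`]-oo, u]%classic `|` `]u, v]%classic) =
    normal_prob 0 1 `]-oo, u]%classic + normal_prob 0 1 `]u, v]%classic.
  apply: measureU; [exact: measurable_itv|exact: measurable_itv|].
  apply/seteqP; split => // x /=; rewrite !in_itv/= => -[xu /andP[ux _]].
  by move: (lt_le_trans ux xu); rewrite ltxx.
by rewrite EFinB -cdfE U E cdfE addeAC subee ?add0e.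
Qed.

Let normal_peak1 : normal_peak 1 = (Num.sqrt (2 * pi))^-1%R :> R.
Proof. by rewrite /normal_peak expr1n mul1r mulr_natl. Qed.

Let phi_mul_le u : (phi u * `|u| <= (Num.sqrt (2 * pi))^-1)%R.
Proof.
rewrite normal_pdf01E normal_peak1 -mulrA ler_piMr ?invr_ge0//.
rewrite expRN mulrC ler_pdivrMr ?expR_gt0// mul1r.
apply: le_trans (expR_ge1Dx _); rewrite -(real_normK (num_real u)).
by have := sqr_ge0 (`|u| - 1)%R; lra.
Qed.

Let phi_le u : (phi u <= (Num.sqrt (2 * pi))^-1)%R.
Proof. by rewrite -normal_peak1 normal_pdf_ub// oner_neq0. Qed.

(** At speed d/dp, the end point u = w / p + b p moves by - u / p + 2 b, and
    both phi and phi(u) |u| are at most 1 / sqrt (2 pi). *)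
Lemma normal_prob_scale_itv w b (p q u v : R) : (0 < q)%R -> (q <= p)%R ->
  (u = w / p + b * p)%R -> (v = w / q + b * q)%R ->
  normal_prob 0 1 `[Num.min u v, Num.max u v]%classic <=
  ((ln p - ln q + 2 * `|b| * (p - q)) / Num.sqrt (2 * pi))%:E.
Proof.
move=> q0 qp uE vE; have p0 : (0 < p)%R by exact: lt_le_trans qp.
pose c : R := (Num.sqrt (2 * pi))^-1%R.
pose end_ (s : R) := (w / s + b * s)%R.
pose G (e s : R) := (e * cdf (end_ s) - c * (ln s + 2 * `|b| * s))%R.
pose dG (e s : R) :=
  (e * (phi (end_ s) * (- w / s ^+ 2 + b)) - c * (s^-1 + 2 * `|b|))%R.
have dGE (e s : R) : (0 < s)%R -> is_derive s 1%R (G e) (dG e s).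
  move=> s0.
  have dend : is_derive s 1%R end_ (- w / s ^+ 2 + b)%R.
    have s_neq0 : s != 0%R by rewrite gt_eqF.
    have dV := is_deriveV s_neq0 (is_derive_id s 1%R).
    rewrite /end_; apply: is_derive_eq.
    by rewrite /GRing.scale/=; field.
  have dcdf := cdf_derive (end_ s).
  have dcomp := is_derive1_comp dcdf dend.
  have dln := is_derive1_ln s0.
  rewrite /G; apply: is_derive_eq.
  by rewrite /GRing.scale/= mulr1.
have dG_le0 (e s : R) : (`|e| = 1)%R -> (0 < s)%R -> (dG e s <= 0)%R.
  move=> e1 s0; rewrite subr_le0 (le_trans (ler_norm _))// normrM e1 mul1r.
  have -> : (- w / s ^+ 2 + b = - (end_ s) / s + 2 * b)%R.
    by rewrite /end_; field; rewrite gt_eqF.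
  rewrite normrM ger0_norm ?normal_pdf_ge0//.
  apply: (@le_trans _ _ (phi (end_ s) * (`|end_ s| / s + 2 * `|b|))%R).
    rewrite ler_wpM2l ?normal_pdf_ge0// (le_trans (ler_normD _ _))//.
    by rewrite !normrM normrN normfV (gtr0_norm s0) normr_nat.
  rewrite !mulrDr mulrA lerD//.
    by rewrite ler_wpM2r ?phi_mul_le// invr_ge0 ltW.
  by rewrite ler_wpM2r ?phi_le// mulr_ge0.
have Gle (e : R) : (`|e| = 1)%R -> (G e p <= G e q)%R.
  move=> e1; move: qp; rewrite le_eqVlt => /predU1P[->//|qp].
  have [s qs||s] := @MVT R (G e) (dG e) q p qp.
  - by apply: dGE; move: qs; rewrite in_itv/= => /andP[+ _]; exact: lt_trans.
  - apply: derivable_within_continuous => s; rewrite in_itv/= => /andP[qs _].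
    by apply: ex_derive; apply: dGE; exact: lt_le_trans qs.
  rewrite in_itv/= => /andP[qs _] E; rewrite -subr_le0 E.
  by rewrite mulr_le0_ge0 ?subr_ge0 ?(ltW qp)// dG_le0//; exact: lt_trans qs.
have : (`|cdf u - cdf v| <= (ln p - ln q + 2 * `|b| * (p - q)) / Num.sqrt (2 * pi))%R.
  have := Gle 1%R (@normr1 R); have := Gle (-1)%R (normrN1 R).
  rewrite /G /end_ -uE -vE /c => H1 H2.
  rewrite ler_norml; apply/andP; split; lra.
move=> H; rewrite normal_prob_itv ?lee_fin; last by rewrite ge_min le_max lexx.
by have [uv|vu] := leP u v; [rewrite distrC in H|]; exact: le_trans (ler_norm _) H.
Qed.

End normal_interval.

Section layer_cake.
Local Open Scope ereal_scope.
Context (R : realType) d (T : measurableType d).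
Local Notation mu := (@lebesgue_measure R).
Local Notation rR := (measurableTypeR R).

(** The distance of two numbers is the measure of the levels separating them,
    so the expected distance is at most the length of the range times the
    largest probability that a level separates. *)
Lemma integral_separation_le (P : probability T R) (a b : T -> R) (L U k : R) :
  measurable_fun [set: T] a -> measurable_fun [set: T] b ->
  (L <= U)%R -> (0 <= k)%R ->
  (forall z, L <= a z <= U)%R -> (forall z, L <= b z <= U)%R ->
  (forall v, (L < v)%R -> (v <= U)%R ->
    P [set z | (a z < v)%R (+) (b z < v)%R] <= k%:E) ->
  \int[P]_z `|a z - b z|%:E <= ((U - L) * k)%:E.
Proof.
move=> ma mb LU k0 aLU bLU Pk.
pose chi (q : T * rR) : bool := (a q.1 < q.2)%R (+) (b q.1 < q.2)%R.
pose F (q : T * rR) : R := if chi q then 1%R else 0%R.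
have ma2 : measurable_fun [set: T * rR] (fun q : T * rR => (a q.1 < q.2)%R).
  apply: measurable_fun_ltr; last exact: measurable_snd.
  exact: (measurableT_comp ma measurable_fst).
have mb2 : measurable_fun [set: T * rR] (fun q : T * rR => (b q.1 < q.2)%R).
  apply: measurable_fun_ltr; last exact: measurable_snd.
  exact: (measurableT_comp mb measurable_fst).
have mF : measurable_fun [set: T * rR] F.
  rewrite (_ : F = fun q => if (a q.1 < q.2)%R then
      (if (b q.1 < q.2)%R then 0%R else 1%R)
      else (if (b q.1 < q.2)%R then 1%R else 0%R)).
    apply: measurable_fun_ifT => //; exact: measurable_fun_ifT.
  by apply/funext => q; rewrite /F /chi; case: (_ < _)%R; case: (_ < _)%R.
have mF' : measurable_fun [set: T * rR] (fun q => (F q)%:E) by exact/measurable_EFinP.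
have F0 q : (0 <= F q)%R by rewrite /F; case: ifP.
have dist z : `|a z - b z|%:E = \int[mu]_v (F (z, v))%:E.
  have -> : `|a z - b z|%:E = mu `]Num.min (a z) (b z), Num.max (a z) (b z)]%classic.
    rewrite [RHS](lebesgue_measure_itv `]_, _])/= lte_fin.
    have [ab|ba|->] := ltgtP (a z) (b z).
    - by rewrite ab distrC gtr0_norm// subr_gt0.
    - by rewrite ba gtr0_norm// subr_gt0.
    - by rewrite ltxx subrr normr0.
  rewrite measure_integral_indic; last exact: measurable_itv.
  apply: eq_integral => v _; congr EFin; rewrite indicE /F /chi/= mem_setE in_itv/=.
  rewrite gt_min le_max (leNgt v) (leNgt v).
  by case: (a z < v)%R; case: (b z < v)%R.
under eq_integral do rewrite dist.
rewrite (fubini_tonelli (fun q => (F q)%:E) mF'); last by move=> q; rewrite lee_fin.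
have -> : ((U - L) * k)%:E = \int[mu]_v (k * \1_(`]L, U]%classic) v)%:E.
  under eq_integral do rewrite EFinM.
  rewrite ge0_integralZl//.
  - rewrite -measure_integral_indic; last by apply: measurable_itv.
    rewrite [X in _ = _ * X](lebesgue_measure_itv `]L, U])/= lte_fin mulrC EFinM.
    move: LU; rewrite le_eqVlt => /predU1P[->|->]; last by rewrite EFinB.
    by rewrite ltxx subrr.
  - by apply/measurable_EFinP/measurable_indic; exact: measurable_itv.
apply: ge0_le_integral => //.
- by move=> v _; apply: integral_ge0 => z _; rewrite lee_fin.
- apply: (@measurable_fun_fubini_tonelli_G _ _ T rR R P (fun q => (F q)%:E)) => //.
- by apply/measurable_EFinP; apply: measurable_funM.
move=> v _; rewrite indicE mem_setE in_itv/=.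
have [Lv|vL] := ltP L v; last first.
  rewrite mulr0 integral0_eq// => z _; rewrite /F /chi/=.
  have /andP[La _] := aLU z; have /andP[Lb _] := bLU z.
  by rewrite !ltNge (le_trans vL La) (le_trans vL Lb).
have [vU|Uv] := leP v U; last first.
  rewrite mulr0 integral0_eq// => z _; rewrite /F /chi/=.
  have /andP[_ aU] := aLU z; have /andP[_ bU] := bLU z.
  by rewrite (le_lt_trans aU Uv) (le_lt_trans bU Uv).
rewrite mulr1 (le_trans _ (Pk v Lv vU))//.
have mS : measurable [set z | (a z < v)%R (+) (b z < v)%R].
  have mFv : measurable_fun [set: T] (fun z => F (z, v)).
    exact: (measurableT_comp mF (measurable_pair2 v)).
  rewrite (_ : [set _ | _] = (fun z => F (z, v)) @^-1` [set 1%R]).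
    rewrite -[X in measurable X]setTI; apply: mFv => //; exact: measurable_set1.
  apply/seteqP; split => z /=; rewrite /F /chi/=; first by move=> ->.
  by case: ifP => // _ /esym/eqP; rewrite oner_eq0.
rewrite [leRHS]measure_integral_indic//.
apply: ge0_le_integral => //.
- by move=> z _; rewrite lee_fin.
- apply/measurable_EFinP; exact: (measurableT_comp mF (measurable_pair2 v)).
- exact/measurable_EFinP/measurable_indic.
by move=> z _; rewrite lee_fin indicE /F; case: ifPn => [h|_]; [rewrite mem_set|exact: ler0n].
Qed.

End layer_cake.

Section gibbs_pot_contraction.
Local Open Scope ereal_scope.
Context (R : realType) (J : nat) (Y : 'I_J -> R) (alpha beta : R).
Hypotheses (hJ : (1 <= J)%N) (halpha : (0 < alpha)%R).
Local Notation rR := (measurableTypeR R).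
Local Notation m := (gibbs_shape J alpha).
Local Notation Yb := (gibbs_mean Y).
Local Notation S0 := (gibbs_Sigma0 Y beta).
Local Notation rate := (gibbs_rate Y beta).
Local Notation shift := (gibbs_shift Y 1).
Local Notation noise := (gibbs_noise J alpha).
Local Notation f := (gibbs_map Y beta 1).
Local Notation pot := (gibbs_pot Y).
Local Notation p := (gibbs_sd J (1 : R)).
Implicit Types (s t x y z g v : R).
Hypothesis hS0 : (0 < S0)%R.

Let J_gt0 : (0 < J%:R :> R)%R. Proof. by rewrite ltr0n. Qed.

Let pot_abs s : pot `|s|%R = pot s.
Proof. by rewrite /gibbs_pot normr_id. Qed.

Let mpot : measurable_fun [set: rR] pot.
Proof. by apply: continuous_measurable_fun; exact: continuous_gibbs_pot. Qed.

(** The level set of w |-> pot (G / rate w) is the complement of a centred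
    interval, of radius r given by rate r = G / t where v = pot t. *)
Let pot_levelP (G v : R) : (0 <= G)%R -> (pot 0 < v)%R -> (v <= pot (G / S0))%R ->
  exists2 r : R, (0 <= r)%R &
    forall w, (pot (G / rate w) < v)%R = (r < `|w|)%R.
Proof.
move=> G0 v0 vG.
have GS0 : (0 <= G / S0)%R by rewrite divr_ge0// ltW.
have [|t] := @IVT R pot 0%R (G / S0)%R v GS0
  (continuous_subspaceT (@continuous_gibbs_pot R J Y)).
  rewrite ge_min le_max (ltW v0) vG orbT//.
rewrite in_itv/= => /andP[t0 tG] potv.
have {}t0 : (0 < t)%R.
  by rewrite lt_neqAle t0 andbT; apply: contraTneq v0 => t0'; rewrite -potv -t0' ltxx.
have rho0 : (0 <= 2 / J%:R * (G / t - S0))%R.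
  rewrite mulr_ge0 ?divr_ge0// subr_ge0 ler_pdivlMr//.
  by rewrite mulrC -ler_pdivlMr.
exists (Num.sqrt (2 / J%:R * (G / t - S0))) => // w.
have D0 := gibbs_rate_gt0 hS0 w.
have -> : (pot (G / rate w) < v)%R = (G / rate w < t)%R.
  have Gw : (0 <= G / rate w)%R by rewrite divr_ge0// ltW.
  rewrite -potv; apply/idP/idP; last exact: gibbs_pot_lt.
  by apply: contraTT; rewrite -!leNgt => tw; apply: gibbs_pot_le => //; exact: ltW.
rewrite ltr_pdivrMr// mulrC -ltr_pdivrMr//.
rewrite -[RHS](@ltr_pXn2r _ 2)// ?nnegrE// sqr_sqrtr// real_normK ?num_real//.
rewrite -[RHS]ltr_pdivlMl ?divr_gt0// invf_div ltrBlDl.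
by rewrite /gibbs_rate mulrAC.
Qed.

(* The z at which the shift from s equals r. *)
Let shift_end s (r : R) : R := (r / p s + Yb * p s)%R.

Let normal_separation_le x y (r : R) : (0 < x)%R -> (0 < y)%R -> (p y <= p x)%R ->
  normal_prob 0 1
    `[Num.min (shift_end x r) (shift_end y r),
      Num.max (shift_end x r) (shift_end y r)]%classic <=
  (2^-1 * `|pot x - pot y|)%:E.
Proof.
move=> x0 y0 pyx.
apply: (le_trans (normal_prob_scale_itv (gibbs_sd1_gt0 J (ltW y0)) pyx erefl erefl)).
rewrite lee_fin (gibbs_pot_dist Y (ltW x0) (ltW y0) pyx) mulrA ler_pM2r.
  by rewrite le_eqVlt; apply/orP; left; apply/eqP; field.
by rewrite invr_gt0 sqrtr_gt0 mulr_gt0 ?pi_gt0.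
Qed.

(* The range of the potential after one step, which the layers of
   [integral_separation_le] have to fill. *)
Let pot_map_le s z g : (pot 0 <= pot (f (s, (z, g))) <= pot (`|g| / S0))%R.
Proof.
have D0 := gibbs_rate_gt0 hS0 (shift s z).
have E : `|f (s, (z, g))|%R = (`|g| / rate (shift s z))%R.
  by rewrite gibbs_mapE normrM normfV (gtr0_norm D0).
have G0 : (0 <= `|g| / rate (shift s z))%R by rewrite divr_ge0// ltW.
rewrite -(pot_abs (f _)) E !gibbs_pot_le//=.
by rewrite ler_wpM2l// lef_pV2 ?posrE// gibbs_rate_ge.
Qed.

(** A level v separates the two images only if Z lies between the end points
    at which the shifts from x and from y reach r, or between those at which
    they reach - r; each of these two intervals has probability at most half of
    |pot x - pot y|. *)
Lemma gibbs_pot_contract_z x y g : (0 < x)%R -> (0 < y)%R ->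
  \int[normal_prob 0 1]_z `|pot (f (x, (z, g))) - pot (f (y, (z, g)))|%:E <=
  ((pot (`|g| / S0) - pot 0) * `|pot x - pot y|)%:E.
Proof.
move=> x0 y0; wlog pyx : x y x0 y0 / (p y <= p x)%R.
  move=> W; have [|/ltW pxy] := leP (p y) (p x); first exact: W.
  rewrite (distrC (pot x)); under eq_integral do rewrite distrC.
  exact: W.
have mfz s : measurable_fun [set: rR] (fun z : rR => pot (f (s, (z, g)))).
  apply: (measurableT_comp mpot).
  apply: (measurableT_comp (measurable_gibbs_map Y beta 1)).
  by apply: measurable_fun_pair => //; exact: measurable_fun_pair.
apply: integral_separation_le => //.
- by have /andP[] := pot_map_le x 0 g; exact: le_trans.
move=> v v0 vU.
have [r r0 levelP] := pot_levelP (normr_ge0 g) v0 vU.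
have level s z : (pot (f (s, (z, g))) < v)%R = (r < `|shift s z|)%R.
  rewrite -levelP -(pot_abs (f _)) gibbs_mapE normrM normfV.
  by rewrite (gtr0_norm (gibbs_rate_gt0 hS0 _)).
pose I (r : R) := `[Num.min (shift_end x r) (shift_end y r),
  Num.max (shift_end x r) (shift_end y r)]%classic : set rR.
have mI r' : measurable (I r') by exact: measurable_itv.
apply: (@le_trans _ _ (normal_prob 0 1 (I r `|` I (- r)%R))).
  have shift_lt s (r' z : R) : (0 < s)%R ->
      (shift s z < r')%R = (z < shift_end s r')%R.
    move=> s0; have ps := gibbs_sd1_gt0 J (ltW s0).
    rewrite (gibbs_shift_sd Y hJ ler01 _ s0)// mulr1 ltrBlDr -ltr_pdivlMr//.
    by congr (_ < _)%R; rewrite /shift_end; field; rewrite gt_eqF.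
  have lt_shift s (r' z : R) : (0 < s)%R ->
      (r' < shift s z)%R = (shift_end s r' < z)%R.
    move=> s0; have ps := gibbs_sd1_gt0 J (ltW s0).
    rewrite (gibbs_shift_sd Y hJ ler01 _ s0)// mulr1 ltrBrDr -ltr_pdivrMr//.
    by congr (_ < _)%R; rewrite /shift_end; field; rewrite gt_eqF.
  rewrite le_measure ?inE//.
  - rewrite (_ : [set _ | _] = [set z | (pot (f (x, (z, g))) < v)%R] `\`
      [set z | (pot (f (y, (z, g))) < v)%R] `|`
      [set z | (pot (f (y, (z, g))) < v)%R] `\`
      [set z | (pot (f (x, (z, g))) < v)%R]).
      have mlt s : measurable ([set z | (pot (f (s, (z, g))) < v)%R] : set rR).
        rewrite (_ : [set _ | _] = (fun z : rR => pot (f (s, (z, g)))) @^-1` `]-oo, v[).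
          by rewrite -[X in measurable X]setTI; apply: mfz => //; exact: measurable_itv.
        by apply/seteqP; split => z /=; rewrite in_itv.
      by apply: measurableU; exact: measurableD.
    apply/seteqP; split => z /=.
      by case: (_ < _)%R; case: (_ < _)%R => //= _; [left|right].
    by case=> -[]; case: (_ < _)%R; case: (_ < _)%R => //= _ /(_ isT).
  - exact: measurableU.
  - move=> z /=; rewrite !level !ltr_normr !(ltrNr r).
    rewrite !lt_shift// !shift_lt// /I/= !in_itv/= !ge_min !le_max.
    case: (ltP z (shift_end x (- r))) => xz; case: (ltP z (shift_end y (- r))) => yz.
    - by rewrite !orbT.
    - by move=> _; right; rewrite (ltW xz).
    - by move=> _; right; rewrite (ltW yz) !orbT.
    rewrite !orbF; case: (ltP (shift_end x r) z) => xz'; case: (ltP (shift_end y r) z) => yz' //.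
    - by move=> _; left; rewrite (ltW xz') orbT.
    - by move=> _; left; rewrite (ltW yz') orbT.
apply: (@le_trans _ _ (normal_prob 0 1 (I r) + normal_prob 0 1 (I (- r)%R))).
  exact: measureU2.
rewrite (_ : `|pot x - pot y|%R = (2^-1 * `|pot x - pot y| +
  2^-1 * `|pot x - pot y|)%R); last by field.
by rewrite EFinD leeD// normal_separation_le.
Qed.

(** Concavity of the potential.  For u = p t and u0 = p t0 the logarithmic part
    is ln z <= z - 1 at z = (u0 / u) ^ 2; the other part amounts to
    (u - u0) ^ 2 (2 u + u0) >= 0. *)
Lemma gibbs_pot_tangent t0 : (0 <= t0)%R ->
  exists2 c : R, (0 <= c)%R &
    forall t, (0 <= t)%R -> (pot t <= pot t0 + c * (t - t0))%R.
Proof.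
move=> h0; have a0 := gibbs_sd1_gt0 J h0.
have S2 : (0 < Num.sqrt (2 * pi) :> R)%R by rewrite sqrtr_gt0 mulr_gt0 ?pi_gt0.
exists (J%:R * (p t0 ^+ 2 + 2 * `|Yb| * p t0 ^+ 3) / Num.sqrt (2 * pi))%R.
  have e n : (0 <= p t0 ^+ n)%R by rewrite exprn_ge0// ltW.
  rewrite divr_ge0// mulr_ge0// addr_ge0//; apply: mulr_ge0 => //; exact: mulr_ge0.
move=> t t_ge0; have a1 := gibbs_sd1_gt0 J t_ge0.
rewrite -lerBlDl gibbs_pot_diff// [leRHS]mulrAC ler_pM2r ?invr_gt0//.
have Jt : (J%:R * (t - t0) = (p t ^+ 2)^-1 - (p t0 ^+ 2)^-1)%R.
  by rewrite -!gibbs_sd1_sqr//; ring.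
rewrite [leRHS]mulrAC Jt.
have l1 : (2 * (ln (p t0) - ln (p t)) <= (p t0 / p t) ^+ 2 - 1)%R.
  rewrite (_ : 2 * _ = ln ((p t0 / p t) ^+ 2))%R; last first.
    by rewrite lnXn ?divr_gt0// ln_div ?posrE// mulr2n; ring.
  have z0 : (0 < (p t0 / p t) ^+ 2)%R by rewrite exprn_gt0// divr_gt0.
  have := le_ln1Dx (x := ((p t0 / p t) ^+ 2 - 1)%R).
  by rewrite ltrBrDl subrr => /(_ z0); rewrite addrC subrK.
have l2 : (2 * (p t0 - p t) <= ((p t ^+ 2)^-1 - (p t0 ^+ 2)^-1) * p t0 ^+ 3)%R.
  rewrite -subr_ge0 (_ : _ - _ = (p t - p t0) ^+ 2 * (2 * p t + p t0) / p t ^+ 2)%R.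
    have h1 : (0 <= 2 * p t + p t0)%R by rewrite ltW// addr_gt0// mulr_gt0.
    by rewrite divr_ge0 ?sqr_ge0// mulr_ge0 ?sqr_ge0.
  by field; rewrite (gt_eqF a0) (gt_eqF a1).
rewrite [leRHS]mulrDr lerD//.
  rewrite (le_trans l1)// le_eqVlt; apply/orP; left; apply/eqP.
  by field; rewrite (gt_eqF a0) (gt_eqF a1).
rewrite [leLHS](_ : _ = 2 * `|Yb| * (2 * (p t0 - p t)))%R; last by ring.
by rewrite [leRHS]mulrCA ler_wpM2l// mulr_ge0.
Qed.

(** Jensen's inequality for the concave potential and the mean m of G. *)
Lemma gibbs_pot_jensen :
  \int[gamma_prob m]_g (pot (`|g| / S0) - pot 0)%:E <= (pot (m / S0) - pot 0)%:E.
Proof.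
have m0 := gibbs_shape_gt0 hJ halpha.
have mS : (0 <= m / S0)%R by rewrite divr_ge0// ltW.
have [c c0 tangent] := gibbs_pot_tangent mS.
rewrite (_ : pot (m / S0) - pot 0 =
  (pot (m / S0) - c * (m / S0) - pot 0) + c / S0 * m)%R; last by ring.
have cS0 : (0 <= c / S0)%R by rewrite divr_ge0// ltW.
have mabs : measurable_fun [set: rR] (fun g : rR => `|g|%R).
  exact: normr_measurable.
apply: (@integral_cstD_le R _ rR (gamma_prob m) _ (fun g => c / S0 * `|g|)%R).
- by rewrite subr_ge0; have := tangent 0%R (lexx _); rewrite sub0r mulrN.
- apply: measurable_funB => //; apply: (measurableT_comp mpot).
  exact: measurable_funM.
- by move=> g; rewrite subr_ge0 gibbs_pot_le// divr_ge0// ltW.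
- exact: measurable_funM.
- by move=> g; rewrite mulr_ge0.
- move=> g; have gS : (0 <= `|g| / S0)%R by rewrite divr_ge0// ltW.
  have := tangent _ gS; rewrite -lerBlDr => h; rewrite lerBlDr (le_trans (tangent _ gS))//.
  by rewrite le_eqVlt; apply/orP; left; apply/eqP; field; rewrite gt_eqF.
apply: (@ge0_integralZl_le R _ rR _ (fun g => `|g|%R)) => //.
by rewrite gamma_mean.
Qed.

Lemma gibbs_pot_contract x y : (0 < x)%R -> (0 < y)%R ->
  \int[noise]_w `|pot (f (x, w)) - pot (f (y, w))|%:E <=
  ((pot (m / S0) - pot 0) * `|pot x - pot y|)%:E.
Proof.
move=> x0 y0.
have mfs s : measurable_fun [set: rR * rR] (fun w : rR * rR => pot (f (s, w))).
  apply: (measurableT_comp mpot).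
  exact: (measurableT_comp (measurable_gibbs_map Y beta 1) (measurable_pair1 s)).
have mF : measurable_fun [set: rR * rR]
    (fun w : rR * rR => `|pot (f (x, w)) - pot (f (y, w))|%:E).
  by apply/measurable_EFinP; exact: measurable_normrB.
have mabs : measurable_fun [set: rR] (fun g : rR => `|g|%R).
  exact: normr_measurable.
have mjensen : measurable_fun [set: rR] (fun g : rR => pot (`|g| / S0) - pot 0)%R.
  apply: measurable_funB => //; apply: (measurableT_comp mpot).
  exact: measurable_funM.
have jensen0 g : (0 <= pot (`|g| / S0) - pot 0)%R.
  by rewrite subr_ge0 gibbs_pot_le// divr_ge0// ltW.
rewrite fubini_tonelli2//.
apply: (@le_trans _ _ (\int[gamma_prob m]_g
    (`|pot x - pot y| * (pot (`|g| / S0) - pot 0))%:E)).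
  apply: ge0_le_integral => //.
  - by move=> g _; apply: integral_ge0 => z _; rewrite lee_fin.
  - exact: measurable_fun_fubini_tonelli_G.
  - by apply/measurable_EFinP; exact: measurable_funM.
  - by move=> g _; rewrite mulrC; exact: gibbs_pot_contract_z.
rewrite mulrC; apply: ge0_integralZl_le => //; exact: gibbs_pot_jensen.
Qed.

Lemma gibbs_pot_start_le x : (0 < x)%R ->
  \int[noise]_w `|pot x - pot (f (x, w))|%:E <=
  (J%:R * (2 * `|Yb| + 1) / Num.sqrt (2 * pi) * (x + m / S0))%:E.
Proof.
move=> x0.
have mfs : measurable_fun [set: rR * rR] (fun w : rR * rR => f (x, w)).
  exact: (measurableT_comp (measurable_gibbs_map Y beta 1) (measurable_pair1 x)).
have L0 : (0 <= J%:R * (2 * `|Yb| + 1) / Num.sqrt (2 * pi) :> R)%R.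
  by rewrite divr_ge0// mulr_ge0// addr_ge0// mulr_ge0.
apply: (@le_trans _ _ (\int[noise]_w (J%:R * (2 * `|Yb| + 1) / Num.sqrt (2 * pi) *
    `|x - f (x, w)|)%:E)).
  apply: ge0_le_integral => //.
  - by apply/measurable_EFinP; apply: measurable_normrB => //; exact: (measurableT_comp mpot).
  - by apply/measurable_EFinP; apply: measurable_funM => //; exact: measurable_normrB.
  move=> w _; rewrite lee_fin -(pot_abs (f _)).
  rewrite (le_trans (gibbs_pot_lipschitz Y (ltW x0) (normr_ge0 _)))// ler_wpM2l//.
  by rewrite -{1}(gtr0_norm x0) ler_dist_dist.
apply: ge0_integralZl_le => //; first exact: measurable_normrB.
exact: gibbs_start_le.
Qed.

End gibbs_pot_contraction.

(** * Rates of convergence *)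

Section gibbs_wasserstein.
Context (R : realType) (J : nat) (Y : 'I_J -> R) (alpha beta : R).
Hypotheses (hJ : (1 <= J)%N) (halpha : 0 < alpha).
Local Notation rR := (measurableTypeR R).
Local Notation m := (gibbs_shape J alpha).
Local Notation Yb := (gibbs_mean Y).
Local Notation S0 := (gibbs_Sigma0 Y beta).
Local Notation noise := (gibbs_noise J alpha).
Local Notation f K := (gibbs_map Y beta K).
Local Notation dW K n x := (wasserstein (kernel_iter (gibbs_kernel Y alpha beta K) n x)
  (gibbs_stationary Y alpha beta K)).
Implicit Types (s t x y K : R).
Hypothesis hS0 : 0 < S0.

Let m_gt0 : 0 < m. Proof. exact: gibbs_shape_gt0. Qed.

Let J_gt0 : 0 < J%:R :> R. Proof. by rewrite ltr0n. Qed.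

(** For r = rho + eps A the bound eps A <= r provides one more factor r, so
    that A rho ^ n <= r ^ n.+1 / eps. *)
Lemma wasserstein_gibbs K (H : R -> R) (rho r A C C' eps x : R) n :
  0 <= K -> measurable_fun [set: rR] H ->
  0 < rho -> rho <= r -> r < 1 -> 0 <= A -> 0 < eps -> eps * A <= r ->
  C <= eps * C' -> 0 < x -> (1 <= n)%N ->
  (forall s t, 0 < s -> 0 < t ->
    (\int[noise]_w `|H (f K (s, w)) - H (f K (t, w))|%:E <=
     (rho * `|H s - H t|)%:E)%E) ->
  (forall s t, 0 < s -> 0 < t ->
    (\int[noise]_w `|f K (s, w) - f K (t, w)|%:E <= (A * `|H s - H t|)%:E)%E) ->
  (\int[noise]_w `|H x - H (f K (x, w))|%:E <= C%:E)%E ->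
  (dW K n x <= (C' / (1 - r) * r ^+ n)%:E)%E.
Proof.
move=> K0 mH rho0 rhor r1 A0 eps0 Ar CC' x0; case: n => // n _ Hcontract Hf Hstart.
have rho1 : rho < 1 by exact: le_lt_trans r1.
have C0 : 0 <= C.
  by rewrite -lee_fin (le_trans _ Hstart)// integral_ge0// => w _; rewrite lee_fin.
have r0 : 0 <= r by rewrite (le_trans (ltW rho0)).
apply: (le_trans (wasserstein_random_map (measurable_gibbs_map Y beta K)
  (fun h => @gibbs_stationaryP R J Y alpha beta K hJ halpha K0 hS0 h)
  (gibbs_map_gt0 K hJ halpha hS0) mH rho0 rho1 x0 Hcontract Hstart n A0 Hf)).
rewrite lee_fin.
have -> : A * rho ^+ n * (C / (1 - rho)) =
    (eps * A) * rho ^+ n * ((C / eps) / (1 - rho)).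
  by field; rewrite (gt_eqF eps0) subr_eq0 gt_eqF.
rewrite [leRHS](_ : _ = r * r ^+ n * (C' / (1 - r))); last by rewrite exprS; ring.
apply: ler_pM.
- by rewrite !mulr_ge0 ?exprn_ge0// ltW.
- by rewrite !divr_ge0// ?subr_ge0 ltW.
- apply: ler_pM => //; first by rewrite mulr_ge0// ltW.
    by rewrite exprn_ge0// ltW.
  by rewrite lerXn2r ?nnegrE// ltW.
apply: ler_pM.
- by rewrite divr_ge0// ltW.
- by rewrite invr_ge0 subr_ge0 ltW.
- by rewrite ler_pdivrMr// mulrC.
- by rewrite lef_pV2 ?posrE ?subr_gt0// lerD2l lerN2.
Qed.

(** Potential 1 / s: by [gibbs_sd_sqr_diff_inv] the squared shift is Lipschitz
    in 1 / s, and 1 / G has mean 1 / (m - 1).  The inverse moment of one step is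
    (Sigma0 + J / 2 E W ^ 2) / (m - 1), and the numerator is dominated by
    N / Sigma0, as Sigma0 ^ 2 + J Sigma0 E W ^ 2 is the beginning of N. *)
Lemma wasserstein_gibbs_inv K (eps x : R) n
    (c := (`|Yb| * Num.sqrt K + 1) * (`|Yb| * Num.sqrt K + 2^-1))
    (r := c / (m - 1) + eps * (m * c / S0 ^+ 2))
    (q := x * J%:R + K)
    (N := S0 ^+ 2
      + J%:R * S0 / q * ((Yb * K) ^+ 2 / q + 1)
      + J%:R ^+ 2 / (4 * q ^+ 2) *
        ((Yb * K) ^+ 4 / q ^+ 2 + 6 * (Yb * K) ^+ 2 / q + 3))
    (C := (x + m / S0) *
      (Num.max (1 / (eps * x ^+ 2)) 1 + N / (eps * (m - 1) * (m - 2)))) :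
  0 <= K -> 2 < m -> 0 < eps -> r < 1 -> 0 < x -> (1 <= n)%N ->
  (dW K n x <= (C / (1 - r) * r ^+ n)%:E)%E.
Proof.
move=> K0 m2 eps0 r1 x0 n1.
have m1 : 1 < m by rewrite (lt_trans _ m2)// ltr1n.
have m1' : 0 < m - 1 by rewrite subr_gt0.
have m2' : 0 < m - 2 by rewrite subr_gt0.
have c0 : 0 < c.
  by rewrite mulr_gt0// ltr_wpDl// mulr_ge0.
have A0 : 0 < m * c / S0 ^+ 2 by rewrite divr_gt0 ?exprn_gt0// mulr_gt0.
have rho0 : 0 < c / (m - 1) by rewrite divr_gt0.
have q0 : 0 < q by rewrite ltr_wpDr// mulr_gt0.
have sqdiff s t (k : R) : 0 < s -> 0 < t -> 0 <= k ->
    gibbs_sqdiff Y K s t * k <= J%:R^-1 * `|s^-1 - t^-1| * (2 * c) * k.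
  move=> s0 t0 k0; rewrite ler_wpM2r// (le_trans (gibbs_sqdiff_le Y hJ K0 s0 t0))//.
  by rewrite ler_wpM2r ?gibbs_sd_sqr_diff_inv// mulr_ge0// ltW.
apply: (@wasserstein_gibbs K GRing.inv (c / (m - 1)) r (m * c / S0 ^+ 2) _ C eps x n
  K0 (@measurable_invr R) rho0 _ r1 (ltW A0) eps0 _ _ x0 n1 _ _
  (gibbs_inv_start_le hJ K0 hS0 m1 x0)).
- by rewrite lerDl mulr_ge0// ltW.
- by rewrite lerDr ltW.
- set D := S0 + _; have DN : S0 * D <= N.
    rewrite /D gibbs_sd_sqr// -/q.
    rewrite [leLHS](_ : _ = S0 ^+ 2 + J%:R * S0 / q * ((Yb * K) ^+ 2 / q + 1)); last first.
      by field; rewrite gt_eqF.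
    rewrite lerDl; apply: mulr_ge0.
      by rewrite divr_ge0 ?exprn_ge0// mulr_ge0// exprn_ge0// ltW.
    have e2 : 0 <= (Yb * K) ^+ 2 by exact: sqr_ge0.
    have e4 : 0 <= (Yb * K) ^+ 4 by rewrite (exprM _ 2 2) sqr_ge0.
    by rewrite !addr_ge0// divr_ge0 ?sqr_ge0 ?(ltW q0)// mulr_ge0.
  have D0 : 0 <= D.
    by rewrite addr_ge0 ?(ltW hS0)// mulr_ge0// addr_ge0// sqr_ge0.
  rewrite /C mulrCA [in leRHS]mulrDr.
  rewrite (_ : eps * (N / _) = N / ((m - 1) * (m - 2))); last first.
    by field; rewrite (gt_eqF eps0) (gt_eqF m1') (gt_eqF m2').
  have N0 : 0 <= N / ((m - 1) * (m - 2)).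
    by rewrite divr_ge0 ?mulr_ge0 ?(ltW m1') ?(ltW m2')// (le_trans _ DN)// mulr_ge0// ltW.
  have max0 : x^-1 <= x * (eps * Num.max (1 / (eps * x ^+ 2)) 1).
    rewrite -ler_pdivrMl// -ler_pdivrMl// le_max; apply/orP; left.
    rewrite le_eqVlt; apply/orP; left; apply/eqP; field.
    by rewrite (gt_eqF eps0) (gt_eqF x0).
  have DN' : D / (m - 1) <= m / S0 * (N / ((m - 1) * (m - 2))).
    rewrite -ler_pdivrMl; last by rewrite divr_gt0.
    apply: (@le_trans _ _ (S0 * D / ((m - 1) * m))).
      rewrite le_eqVlt; apply/orP; left; apply/eqP; field.
      by rewrite (gt_eqF m_gt0) (gt_eqF hS0) (gt_eqF m1').
    apply: ler_pM => //; first by rewrite mulr_ge0// ltW.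
      by rewrite invr_ge0 mulr_ge0// ltW.
    rewrite lef_pV2 ?posrE ?mulr_gt0// ler_pM2l//; lra.
  apply: (le_trans (lerD max0 DN')).
  have emax0 : 0 <= eps * Num.max (1 / (eps * x ^+ 2)) 1.
    by rewrite mulr_ge0 ?(ltW eps0)// le_max ler01 orbT.
  by rewrite mulrDr lerD// ler_wpM2r// ?lerDl ?lerDr ?(ltW x0)// divr_ge0 ?ltW.
- move=> s t s0 t0; apply: (le_trans (gibbs_inv_diff_le Y beta hJ K0 m1 s0 t0)).
  rewrite lee_fin (le_trans (sqdiff _ _ _ s0 t0 _))//.
    by rewrite divr_ge0 ?divr_ge0// ltW.
  rewrite le_eqVlt; apply/orP; left; apply/eqP; field.
  by rewrite (gt_eqF J_gt0) (gt_eqF m1').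
move=> s t s0 t0; apply: (le_trans (gibbs_diff_le hJ halpha K0 hS0 s0 t0)).
rewrite lee_fin (le_trans (sqdiff _ _ _ s0 t0 _))//.
  by rewrite mulr_ge0 ?divr_ge0 ?exprn_ge0// ltW.
rewrite le_eqVlt; apply/orP; left; apply/eqP; field.
by rewrite (gt_eqF J_gt0) (gt_eqF hS0).
Qed.

(** Potential s, for which the contraction rate and the cost of the last step
    coincide. *)
Lemma wasserstein_gibbs_id (x : R) n
    (r := m * (J%:R ^+ 2 / S0 ^+ 2) * (`|Yb| + 1) * (`|Yb| + 2^-1)) :
  r < 1 -> 0 < x -> (1 <= n)%N ->
  (dW 1%R n x <= ((x + m / S0) / (1 - r) * r ^+ n)%:E)%E.
Proof.
move=> r1 x0 n1.
have r0 : 0 < r by rewrite !mulr_gt0 ?invr_gt0 ?exprn_gt0// ltr_wpDl.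
have diff s t : 0 < s -> 0 < t ->
    (\int[noise]_w `|f 1 (s, w) - f 1 (t, w)|%:E <= (r * `|s - t|)%:E)%E.
  move=> s0 t0; apply: (le_trans (gibbs_diff_le hJ halpha ler01 hS0 s0 t0)).
  rewrite lee_fin.
  have k0 : 0 <= J%:R / 2 / S0 ^+ 2 * m.
    by rewrite mulr_ge0 ?divr_ge0 ?exprn_ge0// ltW.
  apply: (le_trans (ler_wpM2r k0 (gibbs_sqdiff_le Y hJ ler01 s0 t0))).
  rewrite sqrtr1 !mulr1 -[leLHS]mulrA.
  apply: (le_trans (ler_wpM2r _ (gibbs_sd_sqr_diff1 hJ s0 t0))).
    by rewrite mulr_ge0// mulr_ge0// mulr_ge0// addr_ge0.
  rewrite le_eqVlt; apply/orP; left; apply/eqP; rewrite /r; field.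
  by rewrite gt_eqF.
apply: (@wasserstein_gibbs 1 id r r r _ (x + m / S0) 1 x n ler01 (@measurable_id _ _ _)
  r0 (lexx _) r1 (ltW r0) ltr01 _ _ x0 n1 diff diff (gibbs_start_le 1 hJ halpha hS0 x0)).
- by rewrite mul1r.
- by rewrite mul1r.
Qed.

(** Potential [gibbs_pot]: its increment from 0 to m / Sigma0 is the rate. *)
Lemma wasserstein_gibbs_log (eps x : R) n
    (r3 := 1 / Num.sqrt (2 * pi) *
      (4 * `|Yb| * (1 - 1 / Num.sqrt (J%:R * m / S0 + 1))
       + ln (J%:R * m / S0 + 1)))
    (A := (`|Yb| + 1) * m * J%:R * Num.sqrt (2 * pi) / (2 * S0 ^+ 2))
    (r := r3 + eps * A)
    (C := Num.max 1 (J%:R * (2 * `|Yb| + 1) / (eps * Num.sqrt (2 * pi)))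
      * (x + m / S0)) :
  0 < eps -> r < 1 -> 0 < x -> (1 <= n)%N ->
  (dW 1%R n x <= (C / (1 - r) * r ^+ n)%:E)%E.
Proof.
move=> eps0 r1 x0 n1.
have S2 : 0 < Num.sqrt (2 * pi) :> R by rewrite sqrtr_gt0 mulr_gt0 ?pi_gt0.
have mS0 : 0 < m / S0 by rewrite divr_gt0.
have r3E : gibbs_pot Y (m / S0) - gibbs_pot Y 0 = r3.
  rewrite /gibbs_pot normr0 mul0r add0r ln1 sqrtr1 (gtr0_norm mS0).
  rewrite (_ : m / S0 * J%:R = J%:R * m / S0); last by ring.
  by rewrite /r3 divr1; ring.
have r30 : 0 < r3 by rewrite -r3E subr_gt0 gibbs_pot_lt.
have A0 : 0 < A.
  by rewrite divr_gt0 ?mulr_gt0 ?exprn_gt0// ltr_wpDl.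
have contract s t : 0 < s -> 0 < t ->
    (\int[noise]_w `|gibbs_pot Y (f 1 (s, w)) - gibbs_pot Y (f 1 (t, w))|%:E <=
     (r3 * `|gibbs_pot Y s - gibbs_pot Y t|)%:E)%E.
  by move=> s0 t0; rewrite -r3E; exact: gibbs_pot_contract.
apply: (@wasserstein_gibbs 1 (gibbs_pot Y) r3 r A _ C eps x n ler01 _
  r30 _ r1 (ltW A0) eps0 _ _ x0 n1 contract _ (gibbs_pot_start_le hJ halpha hS0 x0)).
- by apply: continuous_measurable_fun; exact: continuous_gibbs_pot.
- by rewrite lerDl mulr_ge0// ltW.
- by rewrite lerDr ltW.
- rewrite /C mulrA ler_wpM2r ?addr_ge0 ?(ltW x0) ?(ltW mS0)//.
  rewrite -ler_pdivrMl// le_max; apply/orP; right.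
  by rewrite le_eqVlt; apply/orP; left; apply/eqP; field; rewrite (gt_eqF S2) (gt_eqF eps0).
move=> s t s0 t0; apply: (le_trans (gibbs_diff_le hJ halpha ler01 hS0 s0 t0)).
have k0 : 0 <= J%:R / 2 / S0 ^+ 2 * m.
  by rewrite mulr_ge0 ?divr_ge0 ?exprn_ge0// ltW.
rewrite lee_fin (le_trans (ler_wpM2r k0 (gibbs_sqdiff_le_pot Y s0 t0)))//.
rewrite le_eqVlt; apply/orP; left; apply/eqP; rewrite /A; field.
by rewrite gt_eqF.
Qed.

End gibbs_wasserstein.

Theorem proposition11 (R : realType) (J : nat) (Y : 'I_J -> R)
    (alpha beta : R) (hJ : (1 <= J)%N) (halpha : 0 < alpha) (hbeta : 0 <= beta)
    (hSigma0 : 0 < gibbs_Sigma0 Y beta) :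
  let m : R := alpha + J%:R / 2 in
  let Ybar : R := gibbs_mean Y in
  let Sigma0 : R := gibbs_Sigma0 Y beta in
  let dW (K : R) (n : nat) (x : R) : \bar R :=
    wasserstein (kernel_iter (gibbs_kernel Y alpha beta K) n x)
                (gibbs_stationary Y alpha beta K) in
  (forall K : R, 0 <= K -> 2 < m ->
    let c : R := (`|Ybar| * Num.sqrt K + 1) * (`|Ybar| * Num.sqrt K + 2^-1) in
    let r1 : R := c / (m - 1) in
    let A : R := m * c / Sigma0 ^+ 2 in
    forall eps : R, 0 < eps ->
    let r : R := r1 + eps * A in
    r < 1 ->
    forall (x : R) (n : nat), 0 < x -> (1 <= n)%N ->
    let q : R := x * J%:R + K in
    let N : R := Sigma0 ^+ 2
      + J%:R * Sigma0 / q * ((Ybar * K) ^+ 2 / q + 1)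
      + J%:R ^+ 2 / (4 * q ^+ 2) *
        ((Ybar * K) ^+ 4 / q ^+ 2 + 6 * (Ybar * K) ^+ 2 / q + 3) in
    let C : R := (x + m / Sigma0) *
      (Num.max (1 / (eps * x ^+ 2)) 1 + N / (eps * (m - 1) * (m - 2))) in
    (dW K n x <= (C / (1 - r) * r ^+ n)%:E)%E)
  /\
  (let r2 : R :=
     m * (J%:R ^+ 2 / Sigma0 ^+ 2) * (`|Ybar| + 1) * (`|Ybar| + 2^-1) in
    r2 < 1 ->
    forall (x : R) (n : nat), 0 < x -> (1 <= n)%N ->
    (dW 1%R n x <= ((x + m / Sigma0) / (1 - r2) * r2 ^+ n)%:E)%E)
  /\
  (let r3 : R := 1 / Num.sqrt (2 * pi) *
     (4 * `|Ybar| * (1 - 1 / Num.sqrt (J%:R * m / Sigma0 + 1))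
      + ln (J%:R * m / Sigma0 + 1)) in
    let Ahat : R :=
      (`|Ybar| + 1) * m * J%:R * Num.sqrt (2 * pi) / (2 * Sigma0 ^+ 2) in
    forall eps : R, 0 < eps ->
    let r : R := r3 + eps * Ahat in
    r < 1 ->
    forall (x : R) (n : nat), 0 < x -> (1 <= n)%N ->
    let C : R := Num.max 1 (J%:R * (2 * `|Ybar| + 1) / (eps * Num.sqrt (2 * pi)))
      * (x + m / Sigma0) in
    (dW 1%R n x <= (C / (1 - r) * r ^+ n)%:E)%E).
Proof.
move=> m Ybar Sigma0 dW; split; [|split].
- move=> K K0 m2 c r1 A eps eps0 r r_lt1 x n x0 n1.
  exact: (wasserstein_gibbs_inv hJ halpha hSigma0).
- move=> r2 r2_lt1 x n x0 n1.
  exact: (wasserstein_gibbs_id hJ halpha hSigma0).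
move=> r3 Ahat eps eps0 r r_lt1 x n x0 n1.
exact: (wasserstein_gibbs_log hJ halpha hSigma0).
Qed.
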